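(* Clique-Identification can be solved in $k^{\mathcal{O}(k)}\cdot n^{\mathcal{O}(1)}$ time, where $n$ is the number of vertices of the input graph.
   Context: All graphs are finite, simple and undirected. An identification of two distinct vertices $u,v$ replaces them with a new vertex adjacent to every vertex of $(N(u)\cup N(v))\setminus\{u,v\}$. Clique-Identification takes as input a graph $G$ and an integer $k\ge 0$ and asks whether $G$ can be transformed into a complete graph by at most $k$ identifications. *)

(* Defs.v *)
From HB Require Import structures.
From mathcomp Require Import all_boot.

Set Implicit Arguments.
Unset Strict Implicit.
Unset Printing Implicit Defensive.

Record sgraph := SGraph {
  vertex :> finType;
  adj : rel vertex;
  adj_sym : symmetric adj;
  adj_irr : irreflexive adj }.

Definition complete (G : sgraph) : Prop :=
  forall x y : G, x != y -> adj x y.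

Section Identification.
Variables (G : sgraph) (u v : G).

(* [None] is the new vertex replacing u and v. *)
Definition ident_vertex : finType := option {x : G | (x != u) && (x != v)}.

Definition ident_adj : rel ident_vertex := fun a b =>
  match a, b with
  | Some x, Some y => adj (val x) (val y)
  | Some x, None | None, Some x => adj u (val x) || adj v (val x)
  | None, None => false
  end.

Lemma ident_adj_sym : symmetric ident_adj.
Proof. by move=> [x|] [y|] //=; rewrite adj_sym. Qed.

Lemma ident_adj_irr : irreflexive ident_adj.
Proof. by move=> [x|] //=; rewrite adj_irr. Qed.

Definition identify : sgraph := SGraph ident_adj_sym ident_adj_irr.

End Identification.

Inductive identifications : nat -> sgraph -> sgraph -> Prop :=
| Ident0 G : identifications 0 G G
| IdentS m (G : sgraph) (u v : G) H :
    u != v -> identifications m (identify u v) H -> identifications m.+1 G H.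

Definition clique_identification (G : sgraph) (k : nat) : Prop :=
  exists m H, [/\ m <= k, identifications m G H & complete H].

(* Random access machine over the natural numbers, with unit cost per executed
   instruction. The only arithmetic operations are addition and truncated
   subtraction: without multiplication the unit-cost measure is polynomially
   related to the running time of Turing machines. A program names finitely many
   registers; the unbounded memory is addressed indirectly through them. *)
Inductive instr :=
| Const (d c : nat)    (* r_d := c *)
| Move (d a : nat)     (* r_d := r_a *)
| Add (d a b : nat)    (* r_d := r_a + r_b *)
| Sub (d a b : nat)    (* r_d := r_a - r_b, truncated *)
| Read (d a : nat)     (* r_d := mem[r_a] *)
| Write (a b : nat)    (* mem[r_a] := r_b *)
| Jump (l : nat)
| JumpZ (a l : nat).   (* jump to l if r_a = 0 *)

Definition program := seq instr.

Record config := Config { pc : nat; reg : nat -> nat; memory : nat -> nat }.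

Definition upd (f : nat -> nat) (i x : nat) : nat -> nat :=
  fun j => if j == i then x else f j.

Definition exec (i : instr) (s : config) : config :=
  let: Config p r m := s in
  match i with
  | Const d c => Config p.+1 (upd r d c) m
  | Move d a => Config p.+1 (upd r d (r a)) m
  | Add d a b => Config p.+1 (upd r d (r a + r b)) m
  | Sub d a b => Config p.+1 (upd r d (r a - r b)) m
  | Read d a => Config p.+1 (upd r d (m (r a))) m
  | Write a b => Config p.+1 r (upd m (r a) (r b))
  | Jump l => Config l r m
  | JumpZ a l => Config (if r a == 0 then l else p.+1) r m
  end.

(* The machine halts when the program counter leaves the program. *)
Definition step (P : program) (s : config) : option config :=
  omap (exec^~ s) (onth P (pc s)).

(* [runs P t s s']: started in s, P halts after exactly t steps, in s'. *)
Inductive runs (P : program) : nat -> config -> config -> Prop :=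
| RunsHalt s : step P s = None -> runs P 0 s s
| RunsStep t s s1 s2 :
    step P s = Some s1 -> runs P t s1 s2 -> runs P t.+1 s s2.

(* r_0 holds the number n of vertices, r_1 holds k, and memory cells
   0, ..., n^2 - 1 hold the adjacency matrix in row-major order; everything else
   is 0. *)
Definition input (G : sgraph) (k : nat) : config :=
  Config 0 (nth 0 [:: #|G|; k])
    (nth 0 [seq nat_of_bool (adj x y) | x <- enum G, y <- enum G]).

(* The answer is "yes" if and only if r_0 is nonzero upon halting. *)
Definition decides_in_time (P : program) (Q : sgraph -> nat -> Prop)
    (T : nat -> nat -> nat) : Prop :=
  forall (G : sgraph) (k : nat), exists t s,
    [/\ runs P t (input G k) s, t <= T #|G| k & reg s 0 != 0 <-> Q G k].

(* Main.v *)
Require Import Defs.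
From HB Require Import structures.
From mathcomp Require Import all_boot.
From mathcomp Require Import zify.

(** The graph G can be turned into a complete graph by k identifications iff its
    n vertices can be labelled with at least n - k labels so that any two label
    classes are joined by an edge. A labelling is reached by successive merges,
    and each merge can be guessed among few pairs. In the current quotient, call
    a vertex heavy if it has more than 2k non-neighbours, and light universal if
    it is not heavy and is adjacent to all other vertices that are not heavy. At
    most 2k vertices take part in merges, and they cover all non-adjacent pairs;
    hence heavy vertices are merged and, as in Buss's kernel for vertex cover,
    at most (2k+1)^2 - 1 vertices are not light universal. The light universal
    vertices are exchangeable, so one of them is enough: if a solution exists,
    some solution merges two of these at most (2k+1)^2 candidates. The machine
    tries all (2k+1)^(4k) sequences of k pairs of candidates.

    The program is written in a language of bounded loops and bounded sums; its
    running time is polynomial in the largest value held by a register, which is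
    k^O(k) n^O(1). *)

Set Implicit Arguments.
Unset Strict Implicit.
Unset Printing Implicit Defensive.

(** * A loop language compiled to the random access machine *)

(** Bounded sums are the only iteration inside expressions; products, quantifiers, counting and
    division all reduce to them. *)
Inductive expr :=
| EConst (c : nat)
| EVar (v : nat)
| EAdd (a b : expr)
| ESub (a b : expr)
| EMem (a : expr)
| ESum (v u : nat) (e : expr).

(** There is no conditional: branching is replaced by arithmetic on truth values. A loop bound is
    read once, on entry, so every statement terminates. *)
Inductive stmt :=
| SSet (v : nat) (e : expr)
| SWrite (a b : expr)
| SSeq (s1 s2 : stmt)
| SFor (v u : nat) (s : stmt).

Fixpoint eval (r m : nat -> nat) (e : expr) : nat :=
  match e with
  | EConst c => c
  | EVar v => r v
  | EAdd a b => eval r m a + eval r m b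
  | ESub a b => eval r m a - eval r m b
  | EMem a => m (eval r m a)
  | ESum v u e => \sum_(i < r u) eval (upd r v i) m e
  end.

Definition state := ((nat -> nat) * (nat -> nat))%type.

Definition set_reg (v : nat) (st : state) (x : nat) : state :=
  (upd st.1 v x, st.2).

Fixpoint sem (s : stmt) (st : state) : state :=
  match s with
  | SSet v e => set_reg v st (eval st.1 st.2 e)
  | SWrite a b => (st.1, upd st.2 (eval st.1 st.2 a) (eval st.1 st.2 b))
  | SSeq s1 s2 => sem s2 (sem s1 st)
  | SFor v u s =>
      foldl (fun st' i => sem s (set_reg v st' i)) st (iota 0 (st.1 u))
  end.

(* [M] bounds the values assigned by [SSet]; loop indices need no condition, as
   they stay below the value of a register. *)
Fixpoint bounded_run (M : nat) (s : stmt) (st : state) : Prop :=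
  match s with
  | SSet v e => eval st.1 st.2 e <= M
  | SWrite _ _ => True
  | SSeq s1 s2 => bounded_run M s1 st /\ bounded_run M s2 (sem s1 st)
  | SFor v u s =>
      forall i, i < st.1 u ->
        bounded_run M s (set_reg v
          (foldl (fun st' j => sem s (set_reg v st' j)) st (iota 0 i)) i)
  end.

Fixpoint evars (e : expr) : nat :=
  match e with
  | EConst _ => 0
  | EVar v => v.+1
  | EAdd a b | ESub a b => maxn (evars a) (evars b)
  | EMem a => evars a
  | ESum v u e => maxn (maxn v.+1 u.+1) (evars e)
  end.

Fixpoint svars (s : stmt) : nat :=
  match s with
  | SSet v e => maxn v.+1 (evars e)
  | SWrite a b => maxn (evars a) (evars b)
  | SSeq s1 s2 => maxn (svars s1) (svars s2)
  | SFor v u s => maxn (maxn v.+1 u.+1) (svars s)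
  end.

Fixpoint esize (e : expr) : nat :=
  match e with
  | EConst _ | EVar _ => 1
  | EAdd a b | ESub a b => esize a + esize b + 1
  | EMem a => esize a + 1
  | ESum v u e => esize e + 13
  end.

(* The value of [e] is left in register [d]; registers below [d] are preserved
   and those above [d] are scratch. The code is placed at address [p]. *)
Fixpoint ecomp (e : expr) (d p : nat) : program :=
  match e with
  | EConst c => [:: Const d c]
  | EVar v => [:: Move d v]
  | EAdd a b => ecomp a d p ++ ecomp b d.+1 (p + esize a) ++ [:: Add d d d.+1]
  | ESub a b => ecomp a d p ++ ecomp b d.+1 (p + esize a) ++ [:: Defs.Sub d d d.+1]
  | EMem a => ecomp a d p ++ [:: Read d d]
  | ESum v u e =>
      [:: Move d u; Const d.+1 0; Move d.+2 v; Const d.+3 0;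
          Defs.Sub d.+4 d d.+3; JumpZ d.+4 (p + 11 + esize e); Move v d.+3]
      ++ ecomp e d.+4 (p + 7)
      ++ [:: Add d.+1 d.+1 d.+4; Const d.+4 1; Add d.+3 d.+3 d.+4;
             Jump (p + 4); Move v d.+2; Move d d.+1]
  end.

Fixpoint ssize (s : stmt) : nat :=
  match s with
  | SSet v e => esize e + 1
  | SWrite a b => esize a + esize b + 1
  | SSeq s1 s2 => ssize s1 + ssize s2
  | SFor v u s => ssize s + 8
  end.

Fixpoint scomp (s : stmt) (d p : nat) : program :=
  match s with
  | SSet v e => ecomp e d p ++ [:: Move v d]
  | SWrite a b => ecomp a d p ++ ecomp b d.+1 (p + esize a) ++ [:: Write d d.+1]
  | SSeq s1 s2 => scomp s1 d p ++ scomp s2 d (p + ssize s1)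
  | SFor v u s =>
      [:: Move d u; Const d.+1 0;
          Defs.Sub d.+2 d d.+1; JumpZ d.+2 (p + 8 + ssize s); Move v d.+1]
      ++ scomp s d.+2 (p + 5)
      ++ [:: Const d.+2 1; Add d.+1 d.+1 d.+2; Jump (p + 2)]
  end.

(** [M] bounds the register values, hence every iteration count. In a sum, 7 instructions accompany
    each evaluation of the body; the other 8 are 4 for set-up, 2 for the last test and 2 for the
    exit. *)
Fixpoint ecost (M : nat) (e : expr) : nat :=
  match e with
  | EConst _ | EVar _ => 1
  | EAdd a b | ESub a b => ecost M a + ecost M b + 1
  | EMem a => ecost M a + 1
  | ESum v u e => M * (ecost M e + 7) + 8
  end.

Fixpoint scost (M : nat) (s : stmt) : nat :=
  match s with
  | SSet v e => ecost M e + 1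
  | SWrite a b => ecost M a + ecost M b + 1
  | SSeq s1 s2 => scost M s1 + scost M s2
  | SFor v u s => M * (scost M s + 6) + 4
  end.

(** * Correctness of the compilation *)

Lemma size_ecomp e d p : size (ecomp e d p) = esize e.
Proof.
elim: e d p => [c|v|a IHa b IHb|a IHa b IHb|a IHa|v u e IHe] d p //=;
  rewrite ?size_cat /= ?IHa ?IHb ?IHe; lia.
Qed.

Lemma size_scomp s d p : size (scomp s d p) = ssize s.
Proof.
elim: s d p => [v e|a b|s1 IH1 s2 IH2|v u s IHs] d p /=;
  rewrite ?size_cat /= ?size_ecomp ?IH1 ?IH2 ?size_cat ?IHs /=; lia.
Qed.

Lemma updE f i x j : upd f i x j = if j == i then x else f j.
Proof. by []. Qed.

Lemma eq_eval D e r r' m :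
  evars e <= D -> (forall j, j < D -> r j = r' j) -> eval r m e = eval r' m e.
Proof.
elim: e r r' => [c|v|a IHa b IHb|a IHa b IHb|a IHa|v u e IHe] r r' //=.
- by move=> vD ->.
- by rewrite geq_max => /andP[aD bD] rr'; rewrite (IHa r r') // (IHb r r').
- by rewrite geq_max => /andP[aD bD] rr'; rewrite (IHa r r') // (IHb r r').
- by move=> aD rr'; rewrite (IHa r r').
rewrite !geq_max -andbA => /and3P[vD uD eD] rr'; rewrite (rr' u) //.
apply: eq_bigr => i _; apply: IHe => // j jD.
by rewrite !updE; case: eqP => // _; apply: rr'.
Qed.

(** Executions that need not end in a halting configuration, so that those of consecutive code
    fragments compose. *)
Inductive star (P : program) : nat -> config -> config -> Prop :=
| Star0 s : star P 0 s s
| StarS t s s1 s2 : step P s = Some s1 -> star P t s1 s2 -> star P t.+1 s s2.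

Lemma star_trans P t1 t2 s1 s2 s3 :
  star P t1 s1 s2 -> star P t2 s2 s3 -> star P (t1 + t2) s1 s3.
Proof.
elim=> [//|t s s' s'' st _ IH] h; rewrite addSn.
exact: StarS st (IH h).
Qed.

Lemma star_runs P t s s' : star P t s s' -> step P s' = None -> runs P t s s'.
Proof.
elim=> [s0 h|u s0 s1 s2 st _ IH h]; first exact: RunsHalt.
exact: RunsStep st (IH h).
Qed.

Definition fetch (P : program) (p : nat) : option instr := onth P p.
Arguments fetch : simpl never.

Fixpoint code_at (P : program) (p : nat) (c : program) : Prop :=
  if c is i :: c' then fetch P p = Some i /\ code_at P p.+1 c' else True.

Lemma code_at_cat P p c1 c2 :
  code_at P p (c1 ++ c2) <-> code_at P p c1 /\ code_at P (p + size c1) c2.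
Proof.
elim: c1 p => [|i c1 IH] p /=; first by rewrite addn0; split=> // -[].
by rewrite IH addSnnS; split=> [[? []]|[[]]].
Qed.

Lemma code_at_self P : code_at P 0 P.
Proof.
suff h P1 P2 : code_at (P1 ++ P2) (size P1) P2 by exact: (h [::] P).
elim: P2 P1 => [//|i P2 IH] P1 /=; split; first by rewrite /fetch; elim: P1.
by rewrite -cat_rcons -(size_rcons P1 i).
Qed.

Lemma star1 P t p i r m s2 :
  fetch P p = Some i -> star P t (exec i (Config p r m)) s2 ->
  star P t.+1 (Config p r m) s2.
Proof. by move=> h; apply: StarS; rewrite /step -[onth _ _]/(fetch P p) h. Qed.

(** Code addresses often agree only up to arithmetic, hence the separate equation on the program
    counter. *)
Lemma star_at P t q p i r m s2 :
  fetch P q = Some i -> q = p -> star P t (exec i (Config p r m)) s2 ->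
  star P t.+1 (Config p r m) s2.
Proof. by move=> + <-; apply: star1. Qed.

Ltac upds := rewrite /= ?updE; repeat case: eqP; try lia.

Section Compile.

Variables (P : program) (M D : nat).

Definition agree (r r' : nat -> nat) d := forall j, j < d -> r j = r' j.

(** [rho] is the register file of the machine and [r] the environment of the expression; they agree
    on the variables, which lie below [D]. Since registers below the target survive, the left
    operand stays in [d] while the right one is computed in [d.+1]. *)
Lemma ecomp_correct e d p rho r m :
  code_at P p (ecomp e d p) -> evars e <= D -> D <= d ->
  agree rho r D -> (forall j, j < D -> r j <= M) ->
  exists t rho',
    [/\ star P t (Config p rho m) (Config (p + esize e) rho' m),
        t <= ecost M e, rho' d = eval r m e & agree rho' rho d].
Proof.
elim: e d p rho r => [c|v|a IHa b IHb|a IHa b IHb|a IHa|v u e IHe] d p rho r /=.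
- move=> [h _] _ _ ag bd; exists 1, (upd rho d c); split=> //.
  + by apply: star1 h _; rewrite /= addn1; apply: Star0.
  + by upds.
  + by move=> j jd; upds.
- move=> [h _] vD dD ag bd; exists 1, (upd rho d (rho v)); split=> //.
  + by apply: star1 h _; rewrite /= addn1; apply: Star0.
  + by rewrite updE eqxx ag.
  + by move=> j jd; upds.
- rewrite geq_max => /code_at_cat[ca /code_at_cat[cb [h _]]] /andP[aD bD] dD ag bd.
  have [t1 [rho1 [st1 le1 v1 ag1]]] := IHa _ _ _ _ ca aD dD ag bd.
  rewrite size_ecomp in cb h; rewrite size_ecomp in h.
  have ag1' : agree rho1 r D by move=> j jD; rewrite ag1 ?ag //; lia.
  have [t2 [rho2 [st2 le2 v2 ag2]]] :=
    IHb _ _ _ _ cb bD (leqW dD) ag1' bd.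
  exists (t1 + (t2 + 1)), (upd rho2 d (rho2 d + rho2 d.+1)); split.
  + apply: star_trans st1 (star_trans st2 (star1 h _)).
    by rewrite /= -addnA -addnS addn1 -addnS addnA; apply: Star0.
  + lia.
  + by rewrite updE eqxx v2 ag2 ?v1.
  + by move=> j jd; rewrite updE; case: eqP => [|_]; [lia|rewrite ag2 ?ag1 //; lia].
- rewrite geq_max => /code_at_cat[ca /code_at_cat[cb [h _]]] /andP[aD bD] dD ag bd.
  have [t1 [rho1 [st1 le1 v1 ag1]]] := IHa _ _ _ _ ca aD dD ag bd.
  rewrite size_ecomp in cb h; rewrite size_ecomp in h.
  have ag1' : agree rho1 r D by move=> j jD; rewrite ag1 ?ag //; lia.
  have [t2 [rho2 [st2 le2 v2 ag2]]] :=
    IHb _ _ _ _ cb bD (leqW dD) ag1' bd.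
  exists (t1 + (t2 + 1)), (upd rho2 d (rho2 d - rho2 d.+1)); split.
  + apply: star_trans st1 (star_trans st2 (star1 h _)).
    by rewrite /= -addnA -addnS addn1 -addnS addnA; apply: Star0.
  + lia.
  + by rewrite updE eqxx v2 ag2 ?v1.
  + by move=> j jd; rewrite updE; case: eqP => [|_]; [lia|rewrite ag2 ?ag1 //; lia].
- move=> /code_at_cat[ca [h _]] aD dD ag bd.
  have [t1 [rho1 [st1 le1 v1 ag1]]] := IHa _ _ _ _ ca aD dD ag bd.
  rewrite size_ecomp in h.
  exists (t1 + 1), (upd rho1 d (m (rho1 d))); split.
  + apply: star_trans st1 (star1 h _).
    by rewrite /= addn1 addnS; apply: Star0.
  + lia.
  + by rewrite updE eqxx v1.
  + by move=> j jd; rewrite updE; case: eqP => [|_]; [lia|rewrite ag1].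
move=> [h0 [h1 [h2 [h3 [h4 [h5 [h6 /code_at_cat[ce]]]]]]]].
rewrite size_ecomp => -[g0 [g1 [g2 [g3 [g4 [g5 _]]]]]].
rewrite !geq_max -andbA => /and3P[vD uD eD] dD ag bd.
have {}ce : code_at P (p + 7) (ecomp e d.+4 (p + 7)).
  by move: ce; congr code_at; lia.
set N := r u.
(* Loop invariant: [d] holds the bound, [d.+1] the partial sum, [d.+2] the saved value of [v] and
   [d.+3] the index, with [k] iterations to go. Register [v] is exempt from the agreement until it
   is restored at the exit. *)
have loop k i acc rho1 : N = i + k -> rho1 d = N -> rho1 d.+1 = acc ->
    rho1 d.+2 = r v -> rho1 d.+3 = i ->
    (forall j, j < d -> j != v -> rho1 j = rho j) ->
  exists t rho2,
    [/\ star P t (Config (p + 4) rho1 m) (Config (p + 11 + esize e) rho2 m),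
        t <= k * (ecost M e + 7) + 2,
        rho2 d.+1 = acc + \sum_(i <= j < N) eval (upd r v j) m e,
        rho2 d.+2 = r v
      & (forall j, j < d -> j != v -> rho2 j = rho j)].
  elim: k i acc rho1 => [|k IHk] i acc rho1 Nik r1d r1a r1s r1i r1j.
    exists 2, (upd rho1 d.+4 (rho1 d - rho1 d.+3)); split=> //.
    - apply: (star_at h4); first lia.
      apply: (star_at h5); first lia.
      rewrite /= updE eqxx r1d r1i Nik addn0 subnn eqxx; exact: Star0.
    - by rewrite Nik addn0 big_geq // addn0; upds.
    - by upds.
    - by move=> j jd jv; rewrite updE; case: eqP => [|_]; [lia|rewrite r1j].
  set rho2 := upd (upd rho1 d.+4 (rho1 d - rho1 d.+3)) v (rho1 d.+3).
  have ag2 : agree rho2 (upd r v i) D.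
    move=> j jD; rewrite /rho2 !updE; case: eqP => // /eqP jv.
    by case: eqP => [|_]; [lia|rewrite r1j ?ag //; lia].
  (* The index is below [r u], itself a register value bounded by [M]. *)
  have bd2 j : j < D -> upd r v i j <= M.
    move=> jD; rewrite updE; case: eqP => _; last exact: bd.
    have := bd _ uD; rewrite -/N; lia.
  have [t3 [rho3 [st3 le3 v3 ag3]]] :=
    IHe _ _ _ _ ce eD (leq_trans dD (ltac:(lia) : d <= d.+4)) ag2 bd2.
  set rho4 := upd (upd (upd rho3 d.+1 (rho3 d.+1 + rho3 d.+4)) d.+4 1)
     d.+3 (rho3 d.+3 + 1).
  have ag3' j : j < d.+4 -> j != v -> rho3 j = rho1 j.
    move=> jd jv; rewrite ag3 // /rho2 !updE (negPf jv).
    by case: eqP => //; lia.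
  have vd : v < d by lia.
  have [||||||t5 [rho5 [st5 le5 v5 s5 ag5]]] :=
      IHk i.+1 (acc + eval (upd r v i) m e) rho4.
  - lia.
  - by rewrite /rho4 !updE; upds; rewrite ag3' //; lia.
  - by rewrite /rho4 !updE; upds; move=> *; rewrite v3 ag3' ?r1a //; lia.
  - by rewrite /rho4 !updE; upds; rewrite ag3' //; lia.
  - by rewrite /rho4 !updE eqxx ag3' ?r1i ?addn1 //; lia.
  - move=> j jd jv; rewrite /rho4 !updE; upds; rewrite ag3' ?r1j //; lia.
  exists (3 + (t3 + (4 + t5))), rho5; split=> //.
  + apply: (star_at h4); first lia.
    apply: (star_at h5); first lia.
    rewrite /= updE eqxx r1d r1i Nik addKn /=.
    apply: (star_at h6); first lia.
    rewrite /= -/rho2.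
    have -> : (p + 4).+3 = p + 7 by lia.
    have -> : upd (upd rho1 d.+4 k.+1) v (upd rho1 d.+4 k.+1 d.+3) = rho2.
      rewrite /rho2 r1d r1i Nik addKn; congr upd.
      by rewrite updE; upds.
    apply: star_trans st3 _.
    apply: (star_at g0); first lia.
    apply: (star_at g1); first lia.
    apply: (star_at g2); first lia.
    apply: (star_at g3); first lia.
    rewrite /=.
    match goal with |- star _ _ (Config _ ?f _) _ => suff -> : f = rho4 by [] end.
    by rewrite /rho4; congr upd; rewrite !updE; upds.
  + lia.
  + by rewrite v5 [in RHS]big_ltn ?addnA //; lia.
pose rho0 := upd (upd (upd (upd rho d (rho u)) d.+1 0) d.+2 (rho v)) d.+3 0.
have [|||||| t [rho2 [st2 le2 v2 s2 ag2]]] := loop N 0 0 rho0; first exact: add0n.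
- by rewrite /rho0 !updE; upds; rewrite ag.
- by rewrite /rho0 !updE; upds.
- by rewrite /rho0 !updE; upds; move=> *; rewrite ag.
- by rewrite /rho0 !updE; upds.
- by move=> j jd jv; rewrite /rho0 !updE; upds.
exists (4 + (t + 2)), (upd (upd rho2 v (rho2 d.+2)) d (rho2 d.+1)); split.
- apply: (star_at h0); first lia.
  apply: (star_at h1); first lia.
  apply: (star_at h2); first lia.
  apply: (star_at h3); first lia.
  rewrite /=.
  have -> : p.+4 = p + 4 by lia.
  match goal with |- star _ _ (Config _ ?f _) _ => have -> : f = rho0 end.
    rewrite /rho0; congr (upd (upd _ _ _) _ _); rewrite !updE; upds.
  apply: star_trans st2 _.
  apply: (star_at g4); first lia.
  apply: (star_at g5); first lia.
  rewrite /=.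
  have -> : (p + 11 + esize e).+2 = p + (esize e + 13) by lia.
  match goal with |- star _ _ (Config _ ?f _) (Config _ ?g _) => have -> : f = g end.
    by congr upd; rewrite !updE; upds.
  exact: Star0.
- have : N <= M by exact: bd.
  rewrite -(leq_pmul2r (_ : 0 < ecost M e + 7)); lia.
- by rewrite updE eqxx v2 big_mkord.
- move=> j jd; rewrite !updE; case: eqP => [|_]; first lia.
  by case: eqP => [->|/eqP jv]; [rewrite s2 ag|apply: ag2].
Qed.

(** Preserving the registers from [D] up to [d] protects the counters of enclosing loops; the bound
    [M] is re-established at the end for the statement that follows. *)
Lemma scomp_correct s d p rho st :
  code_at P p (scomp s d p) -> svars s <= D -> D <= d ->
  agree rho st.1 D -> (forall j, j < D -> st.1 j <= M) -> bounded_run M s st ->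
  exists t rho',
    [/\ star P t (Config p rho st.2) (Config (p + ssize s) rho' (sem s st).2),
        t <= scost M s, agree rho' (sem s st).1 D,
        forall j, D <= j < d -> rho' j = rho j
      & forall j, j < D -> (sem s st).1 j <= M].
Proof.
elim: s d p rho st => [v e|a b|s1 IH1 s2 IH2|v u s IHs] d p rho st /=.
- move=> /code_at_cat[ce [h _]]; rewrite geq_max size_ecomp in h * => /andP[vD eD] dD ag bd br.
  have [t [rho1 [st1 le1 v1 ag1]]] := ecomp_correct st.2 ce eD dD ag bd.
  exists (t + 1), (upd rho1 v (rho1 d)); split.
  + apply: star_trans st1 (star1 h _).
    by rewrite /= addn1 addnS; apply: Star0.
  + lia.
  + move=> j jD; rewrite !updE; case: eqP => _; first by rewrite v1.
    by rewrite ag1 ?ag //; lia.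
  + by move=> j /andP[Dj jd]; rewrite updE; case: eqP => [|_]; [lia|rewrite ag1].
  + by move=> j jD; rewrite updE; case: eqP => // _; apply: bd.
- move=> /code_at_cat[ca /code_at_cat[cb [h _]]]; rewrite geq_max !size_ecomp in cb h *.
  move=> /andP[aD bD] dD ag bd _.
  have [t1 [rho1 [st1 le1 v1 ag1]]] := ecomp_correct st.2 ca aD dD ag bd.
  have ag1' : agree rho1 st.1 D by move=> j jD; rewrite ag1 ?ag //; lia.
  have [t2 [rho2 [st2 le2 v2 ag2]]] :=
    ecomp_correct st.2 cb bD (leqW dD) ag1' bd.
  exists (t1 + (t2 + 1)), rho2; split=> //.
  + apply: star_trans st1 (star_trans st2 (star1 h _)).
    rewrite /= v2 ag2 ?v1 //.
    have -> : (p + esize a + esize b).+1 = p + (esize a + esize b + 1) by lia.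
    exact: Star0.
  + lia.
  + by move=> j jD; rewrite ag2 ?ag1' //; lia.
  + by move=> j jD; rewrite ag2 ?ag1 //; lia.
- move=> /code_at_cat[c1 c2]; rewrite geq_max size_scomp in c2 *.
  move=> /andP[D1 D2] dD ag bd [br1 br2].
  have [t1 [rho1 [st1 le1 ag1 k1 bd1]]] := IH1 _ _ _ _ c1 D1 dD ag bd br1.
  have [t2 [rho2 [st2 le2 ag2 k2 bd2]]] := IH2 _ _ _ _ c2 D2 dD ag1 bd1 br2.
  exists (t1 + t2), rho2; split=> //.
  + by rewrite addnA; apply: star_trans st1 st2.
  + lia.
  + by move=> j jD; rewrite k2 ?k1.
move=> [h0 [h1 [h2 [h3 [h4 /code_at_cat[cs]]]]]].
rewrite size_scomp => -[g0 [g1 [g2 _]]].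
rewrite !geq_max -andbA => /and3P[vD uD sD] dD ag bd br.
have {}cs : code_at P (p + 5) (scomp s d.+2 (p + 5)).
  by move: cs; congr code_at; lia.
set N := st.1 u in br *.
pose F st' i := sem s (set_reg v st' i); rewrite -/F.
(* [d] keeps a copy of the loop bound and [d.+1] the index, out of reach of the body, whose scratch
   registers start at [d.+2]. *)
have loop k i rho1 : N = i + k -> rho1 d = N -> rho1 d.+1 = i ->
    agree rho1 (foldl F st (iota 0 i)).1 D ->
    (forall j, j < D -> (foldl F st (iota 0 i)).1 j <= M) ->
    (forall j, D <= j < d -> rho1 j = rho j) ->
  exists t rho2,
    [/\ star P t (Config (p + 2) rho1 (foldl F st (iota 0 i)).2)
          (Config (p + 8 + ssize s) rho2 (foldl F st (iota 0 N)).2),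
        t <= k * (scost M s + 6) + 2,
        agree rho2 (foldl F st (iota 0 N)).1 D,
        (forall j, D <= j < d -> rho2 j = rho j)
      & forall j, j < D -> (foldl F st (iota 0 N)).1 j <= M].
  elim: k i rho1 => [|k IHk] i rho1 Nik r1d r1i ag1 bd1 k1.
    have iN : i = N by lia.
    rewrite -iN; exists 2, (upd rho1 d.+2 (rho1 d - rho1 d.+1)); split=> //.
    - apply: (star_at h2); first lia.
      apply: (star_at h3); first lia.
      rewrite /= updE eqxx r1d r1i iN subnn eqxx; exact: Star0.
    - by move=> j jD; rewrite updE; case: eqP => [|_]; [lia|apply: ag1].
    - by move=> j jD; rewrite updE; case: eqP => [|_]; [lia|apply: k1].
  set sti := foldl F st (iota 0 i) in ag1 bd1 *.
  set rho2 := upd (upd rho1 d.+2 (rho1 d - rho1 d.+1)) v (rho1 d.+1).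
  have ag2 : agree rho2 (set_reg v sti i).1 D.
    move=> j jD; rewrite /rho2 /= !updE; case: eqP => // /eqP jv.
    by case: eqP => [|_]; [lia|rewrite ag1].
  have bd2 j : j < D -> (set_reg v sti i).1 j <= M.
    move=> jD; rewrite /= updE; case: eqP => _; last exact: bd1.
    have := bd _ uD; rewrite -/N; lia.
  have iN : i < N by lia.
  have [t3 [rho3 [st3 le3 ag3 k3 bd3]]] :=
    IHs _ _ _ _ cs sD (leq_trans dD (ltac:(lia) : d <= d.+2)) ag2 bd2 (br _ iN).
  set rho4 := upd (upd rho3 d.+2 1) d.+1 (rho3 d.+1 + 1).
  have fE : foldl F st (iota 0 i.+1) = sem s (set_reg v sti i).
    by rewrite -addn1 iotaD foldl_cat.
  have k3' j : D <= j < d.+2 -> rho3 j = rho1 j.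
    move=> jd; rewrite k3 // /rho2 !updE; upds.
  have [||||||t5 [rho5 [st5 le5 ag5 k5 bd5]]] := IHk i.+1 rho4.
  - lia.
  - by rewrite /rho4 !updE; upds; rewrite k3' //; lia.
  - by rewrite /rho4 !updE eqxx k3' ?r1i; lia.
  - by rewrite fE => j jD; rewrite /rho4 !updE; upds; rewrite ag3.
  - by rewrite fE.
  - by move=> j jD; rewrite /rho4 !updE; upds; rewrite k3' ?k1 //; lia.
  exists (3 + (t3 + (3 + t5))), rho5; split=> //.
  + apply: (star_at h2); first lia.
    apply: (star_at h3); first lia.
    rewrite /= updE eqxx r1d r1i Nik addKn /=.
    apply: (star_at h4); first lia.
    rewrite /=.
    have -> : (p + 2).+3 = p + 5 by lia.
    have -> : upd (upd rho1 d.+2 k.+1) v (upd rho1 d.+2 k.+1 d.+1) = rho2.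
      rewrite /rho2 r1d r1i Nik addKn; congr upd.
      by rewrite updE; upds.
    apply: star_trans st3 _.
    apply: (star_at g0); first lia.
    apply: (star_at g1); first lia.
    apply: (star_at g2); first lia.
    rewrite /= -fE.
    match goal with |- star _ _ (Config _ ?f _) _ => suff -> : f = rho4 end.
      by rewrite -Nik.
    by rewrite /rho4; congr upd; rewrite !updE; upds.
  + lia.
pose rho0 := upd (upd rho d (rho u)) d.+1 0.
have [|||||| t [rho2 [st2 le2 ag2 k2 bd2]]] := loop N 0 rho0; first exact: add0n.
- by rewrite /rho0 !updE; upds; rewrite ag.
- by rewrite /rho0 !updE; upds.
- by move=> j jD; rewrite /rho0 !updE; upds; rewrite ag.
- exact: bd.
- by move=> j jd; rewrite /rho0 !updE; upds.
exists (2 + t), rho2; split=> //.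
- apply: (star_at h0); first lia.
  apply: (star_at h1); first lia.
  rewrite /=.
  have -> : p.+2 = p + 2 by lia.
  have -> : p + (ssize s + 8) = p + 8 + ssize s by lia.
  exact: st2.
- have : N <= M by exact: bd.
  rewrite -(leq_pmul2r (_ : 0 < scost M s + 6)); lia.
Qed.

End Compile.

(** * Polynomial cost of a fixed program *)

Lemma ecost_poly e : exists C d, forall M, ecost M e <= C * M.+1 ^ d.
Proof.
elim: e => [c|v|a [C1 [d1 h1]] b [C2 [d2 h2]]|a [C1 [d1 h1]] b [C2 [d2 h2]]
           |a [C1 [d1 h1]]|v u e [C1 [d1 h1]]] /=.
1,2: by exists 1, 0.
(* Powers of [M.+1] are at least 1, so each is bounded by their product. Only a bounded sum needs an
   extra factor [M.+1]. *)
1,2: exists (C1 + C2 + 1), (d1 + d2) => M.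
1,2: rewrite expnD; have := h1 M; have := h2 M.
1,2: have := expn_gt0 M.+1 d1; have := expn_gt0 M.+1 d2; rewrite /=; nia.
- exists (C1 + 1), d1 => M; have := h1 M; have := expn_gt0 M.+1 d1; rewrite /=; nia.
- exists (C1 + 15), d1.+1 => M; rewrite expnS.
  have := h1 M; have := expn_gt0 M.+1 d1; rewrite /=; nia.
Qed.

Lemma scost_poly s : exists C d, forall M, scost M s <= C * M.+1 ^ d.
Proof.
elim: s => [v e|a b|s1 [C1 [d1 h1]] s2 [C2 [d2 h2]]|v u s [C1 [d1 h1]]] /=.
- have [C [d h]] := ecost_poly e; exists (C + 1), d => M.
  have := h M; have := expn_gt0 M.+1 d; rewrite /=; nia.
- have [[C1 [d1 h1]] [C2 [d2 h2]]] := (ecost_poly a, ecost_poly b).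
  exists (C1 + C2 + 1), (d1 + d2) => M.
  rewrite expnD; have := h1 M; have := h2 M.
  have := expn_gt0 M.+1 d1; have := expn_gt0 M.+1 d2; rewrite /=; nia.
- exists (C1 + C2), (d1 + d2) => M.
  rewrite expnD; have := h1 M; have := h2 M.
  have := expn_gt0 M.+1 d1; have := expn_gt0 M.+1 d2; rewrite /=; nia.
- exists (C1 + 10), d1.+1 => M; rewrite expnS.
  have := h1 M; have := expn_gt0 M.+1 d1; rewrite /=; nia.
Qed.

(** * Identifications and labellings *)

(** This says that the quotient of the graph on [R] by the labels is complete. The set [R] allows
    for the representatives of a partly merged graph. *)
Definition classes_adjacent (V T : finType) (R : {set V}) (A : rel V)
    (f : V -> T) : Prop :=
  forall x y, x \in R -> y \in R -> f x != f y ->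
  exists x' y', [/\ x' \in R, y' \in R, f x' = f x, f y' = f y & A x' y'].

Lemma card_ident_vertex (G : sgraph) (u v : G) :
  u != v -> #|ident_vertex u v|.+1 = #|G|.
Proof.
move=> uv; rewrite card_option card_sig.
rewrite -(cardC (pred2 u v)) card2 uv addSn add1n; congr _.+2.
by apply: eq_card => x; rewrite !inE negb_or.
Qed.

(** The labelling is the composite of the quotient maps: each identification removes one vertex, and
    an edge of a quotient comes from an edge between preimages. *)
Lemma identifications_labelling m (G H : sgraph) :
  identifications m G H ->
  exists f : G -> H, [/\ #|G| = #|f @: setT| + m, f @: setT = setT
    & forall a b, adj a b -> exists x y, [/\ f x = a, f y = b & adj x y]].
Proof.
elim=> {m G H} [G|m G u v H uv _ [f [cf sf af]]].
  exists id; split=> [||a b ab]; first by rewrite imset_id cardsT addn0.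
    exact: imset_id.
  by exists a, b.
pose g (x : G) : identify u v :=
  if insub x is Some y then Some y else None.
have gE (y : {x : G | (x != u) && (x != v)}) : g (val y) = Some y by rewrite /g valK.
have gu : g u = None by rewrite /g insubN // eqxx.
have gv : g v = None by rewrite /g insubN // eqxx andbF.
have sg b : exists x, g x = b by case: b => [y|]; [exists (val y)|exists u].
exists (f \o g).
have im : (f \o g) @: setT = setT.
  apply/setP => h; rewrite inE; have: h \in f @: setT by rewrite sf inE.
  by case/imsetP=> b _ ->; have [x <-] := sg b; apply: imset_f.
split=> // [|a b ab].
  by rewrite -(card_ident_vertex uv) cf im sf addnS.
have [x [y [<- <-]]] := af _ _ ab.
case: x y => [x|] [y|] //=; rewrite /ident_adj /=.
- by move=> xy; exists (val x), (val y); rewrite !gE.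
- case/orP=> h; [exists (val x), u|exists (val x), v]; rewrite gE ?gu ?gv.
    by rewrite adj_sym.
  by rewrite adj_sym.
- by case/orP=> h; [exists u, (val y)|exists v, (val y)]; rewrite gE ?gu ?gv.
Qed.

(** Induction on the bound [k] for the surplus of vertices over labels: identifying two vertices of
    equal label keeps all labels and removes a vertex, and an injective labelling forces [G] to be
    complete. *)
Lemma labelling_clique_identification k (G : sgraph) (T : finType) (f : G -> T) :
  classes_adjacent setT (@adj G) f -> #|G| <= #|f @: setT| + k ->
  clique_identification G k.
Proof.
elim: k G f => [|k IH] G f fa; last first.
- case: (boolP (injectiveb f)) => [/injectiveP fi _|/injectivePn[u [v uv fuv]] cG].
    exists 0, G; split=> //; first exact: Ident0.
    move=> x y xy; have [|||x' [y' [_ _ /fi -> /fi ->]]] // := fa x y.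
    by rewrite (inj_eq fi).
  (* As [u] and [v] have the same label, [f] factors through the quotient map [g]. *)
  pose f' (a : identify u v) := if a is Some x then f (val x) else f u.
  pose g (x : G) : identify u v :=
    if insub x is Some y then Some y else None.
  have f'g x : f' (g x) = f x.
    rewrite /g /f'; case: insubP => [y _ -> //|].
    by rewrite negb_and !negbK => /orP[]/eqP ->.
  have im : f' @: setT = f @: setT.
    apply/setP => t; apply/imsetP/imsetP => [[a _ ->]|[x _ ->]].
      by case: a => [x|]; [exists (val x)|exists u].
    by exists (g x).
  have [||m [H [mk iH cH]]] := IH (identify u v) f'; last first.
  + by exists m.+1, H; split=> //; apply: IdentS uv iH.
  + by rewrite im; move: cG; rewrite -(card_ident_vertex uv) addnS ltnS.
  have f's a : exists2 x, f' a = f x & a = g x.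
    case: a => [x|]; first by exists (val x) => //; rewrite /g valK.
    by exists u => //; rewrite /g insubN // eqxx.
  move=> a b _ _; have [[x -> _] [y -> _]] := (f's a, f's b).
  move=> fxy; have [x' [y' [_ _ xx yy xy]]] := fa _ _ (in_setT _) (in_setT _) fxy.
  exists (g x'), (g y'); rewrite !f'g !inE; split=> //.
  rewrite /adj /= /ident_adj /g.
  case: insubP => [z _ zx|]; case: insubP => [w _ wy|]; rewrite ?zx ?wy //.
  + by rewrite negb_and !negbK => /orP[]/eqP yu; rewrite -yu [adj y' _]adj_sym xy ?orbT.
  + by rewrite negb_and !negbK => /orP[]/eqP yu; rewrite -yu xy ?orbT.
  (* If both ends of the edge were among [u] and [v], the two labels would coincide. *)
  rewrite !negb_and !negbK => hy hx; case/negP: fxy; rewrite -xx -yy.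
  by case/orP: hx => /eqP ->; case/orP: hy => /eqP ->; rewrite ?fuv.
move=> cG; have fi : injective f.
  have/imset_injP fi : #|f @: setT| == #|[set: G]|.
    by rewrite eqn_leq leq_imset_card cardsT -[#|f @: _|]addn0.
  by move=> x y; apply: fi; rewrite inE.
exists 0, G; split=> //; first exact: Ident0.
move=> x y xy; have [|||x' [y' [_ _ /fi -> /fi ->]]] // := fa x y.
by rewrite (inj_eq fi).
Qed.

(** * Merge candidates *)

Section Kernel.

Variables (n k : nat) (R : {set 'I_n}) (q : rel 'I_n).
Hypothesis q_sym : symmetric q.

Definition nonneighbors (x : 'I_n) := [set y in R | (y != x) && ~~ q x y].

Definition heavy := [set x in R | 2 * k < #|nonneighbors x|].

Definition light_universal :=
  [set x in R | (x \notin heavy) &&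
    [forall y : 'I_n, [&& y \in R, y \notin heavy & y != x] ==> q x y]].

(** One light universal vertex is enough; taking the least one gives a set that a formula of the
    loop language can describe. *)
Definition kernel :=
  [set x in R | ~~ ((x \in light_universal) &&
    [exists y : 'I_n, (y \in light_universal) && (y < x)])].

Section Labelling.

Variables (T : finType) (g : 'I_n -> T) (j : nat).
Hypotheses (g_adj : classes_adjacent R q g) (g_card : #|R| <= #|g @: R| + j).
Hypothesis (le_jk : j <= k).

(** The vertices that take part in merges. *)
Definition touched :=
  [set x in R | [exists y : 'I_n, [&& y \in R, y != x & g y == g x]]].

Lemma touchedP x :
  reflect (x \in R /\ exists y, [/\ y \in R, y != x & g y = g x])
          (x \in touched).
Proof.
rewrite inE; apply: (iffP andP) => -[xR].
  by case/existsP=> y /and3P[yR yx /eqP gyx]; split=> //; exists y.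
by case=> y [yR yx gyx]; split=> //; apply/existsP; exists y; rewrite yR yx gyx /=.
Qed.

(** A class of touched vertices has at least two members, so touched vertices carry at most half as
    many labels as their number; at most [j] labels are missing in all. *)
Lemma card_touched : #|touched| <= 2 * j.
Proof.
have sTR : touched \subset R by apply/subsetP=> x; rewrite inE => /andP[].
have h2 : 2 * #|g @: touched| <= #|touched|.
  rewrite -[X in _ <= X]sum1_card (partition_big_imset g) /=.
  rewrite mulnC -sum_nat_const.
  apply: leq_sum => t /imsetP[x /[dup] xT /touchedP[xR [y [yR yx gyx]]] ->].
  rewrite sum1dep_card.
  have yT : y \in touched.
    by apply/touchedP; split=> //; exists x; rewrite eq_sym.
  apply: leq_trans (subset_leq_card (_ : [set x; y] \subset _)).
    by rewrite cards2 eq_sym yx.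
  by apply/subsetP=> z; rewrite in_set2 => /orP[]/eqP ->; rewrite in_set ?xT ?yT ?gyx /=.
have hR : #|g @: R| <= #|R :\: touched| + #|g @: touched|.
  rewrite -{1}(setID R touched) (setIidPr sTR) imsetU.
  apply: leq_trans (leq_card_setU _ _) _; rewrite addnC leq_add2r.
  exact: leq_imset_card.
have := cardsID touched R; rewrite (setIidPr sTR); lia.
Qed.

(** Two singleton classes can only be joined by an edge between their elements. Hence the touched
    vertices cover all non-adjacent pairs. *)
Lemma nonadjacent_touched x y :
  x \in R -> y \in R -> x != y -> ~~ q x y -> x \notin touched -> y \in touched.
Proof.
move=> xR yR xy qxy xT; apply: contraNT qxy => yT.
have unt z z' : z \in R -> z \notin touched -> z' \in R -> g z' = g z -> z' = z.
  move=> zR zT z'R gz; apply/eqP; apply: contraNT zT => zz.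
  by apply/touchedP; split=> //; exists z'.
have gxy : g x != g y by apply: contraNneq xy => /(unt _ _ yR yT xR) ->.
have [x' [y' [x'R y'R gx gy]]] := g_adj xR yR gxy.
by rewrite (unt x x') // (unt y y').
Qed.

(** All non-neighbours of an untouched vertex are touched, and at most [2 * k] vertices are. *)
Lemma heavy_touched x : x \in heavy -> x \in touched.
Proof.
rewrite inE => /andP[xR xh]; apply: contraLR xh => xT; rewrite -leqNgt.
apply: leq_trans (_ : #|touched| <= _); last first.
  by apply: leq_trans card_touched _; rewrite leq_mul2l.
apply: subset_leq_card; apply/subsetP => y; rewrite inE => /and3P[yR yx qxy].
by apply: nonadjacent_touched qxy xT; rewrite // eq_sym.
Qed.

(** The kernel is covered by the touched vertices, the non-neighbours of the light touched ones and
    one light universal vertex, which gives at most [2 * k + (2 * k) ^ 2 + 1]. *)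
Lemma card_kernel : #|kernel| <= (2 * k + 1) ^ 2.
Proof.
pose light := touched :\: heavy.
have hT : #|touched| <= 2 * k by apply: leq_trans card_touched _; rewrite leq_mul2l.
have hN : #|\bigcup_(t in light) nonneighbors t| <= 2 * k * (2 * k).
  apply: leq_trans (_ : \sum_(t in light) #|nonneighbors t| <= _).
    elim/big_rec2: _ => [|t m A tl IH]; first by rewrite cards0.
    by apply: leq_trans (leq_card_setU _ _) _; rewrite leq_add2l.
  apply: leq_trans (_ : \sum_(t in light) (2 * k) <= _).
    apply: leq_sum => t; rewrite !inE => /andP[+ /andP[tR _]].
    by rewrite tR -leqNgt.
  rewrite sum_nat_const leq_mul2r orbC; apply/orP; left.
  by apply: leq_trans (subset_leq_card (subsetDl _ _)) hT.
have hJ : #|kernel :&: light_universal| <= 1.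
  apply/card_le1_eqP => x y /setIP[]; rewrite inE => /andP[xR xm] xJ.
  move=> /setIP[]; rewrite inE => /andP[yR ym] yJ.
  move: xm ym; rewrite xJ yJ /= => /existsPn xm /existsPn ym.
  apply: val_inj => /=; apply/eqP; rewrite eqn_leq (leqNgt x) (leqNgt y).
  by have := xm y; have := ym x; rewrite xJ yJ /= => -> ->.
have hK : kernel \subset
    touched :|: \bigcup_(t in light) nonneighbors t :|: (kernel :&: light_universal).
  apply/subsetP => x xK; have /andP[xR _] : (x \in R) && true.
    by move: xK; rewrite inE => /andP[->].
  rewrite !in_setU in_setI xK /=.
  case: (boolP (x \in touched)) => //= xT.
  case: (boolP (x \in light_universal)); rewrite ?orbT ?orbF // inE xR /=.
  have xh : x \notin heavy by apply: contra xT; apply: heavy_touched.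
  (* An untouched vertex that is not light universal has a light non-neighbour, which must be
     touched. *)
  rewrite xh /= => /forallPn[y]; rewrite negb_imply => /andP[/and3P[yR yh yx] qxy].
  have yT : y \in touched by apply: nonadjacent_touched qxy xT; rewrite // eq_sym.
  apply/bigcupP; exists y; first by rewrite in_setD yh.
  by rewrite inE xR eq_sym yx q_sym.
have := subset_leq_card hK.
have := (leq_card_setU (touched :|: \bigcup_(t in light) nonneighbors t)
  (kernel :&: light_universal)).1.
have := (leq_card_setU touched (\bigcup_(t in light) nonneighbors t)).1.
have -> : (2 * k + 1) ^ 2 = 2 * k * (2 * k) + 4 * k + 1 by nia.
move: (2 * k * (2 * k)) hN => k2; lia.
Qed.

(* If no class of [g] contains two kernel vertices, let [j0] be the light
   universal vertex of the kernel. Exchanging [j0] with a light universal vertex [b] that is merged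
   with a kernel vertex keeps all classes adjacent: every heavy vertex shares
   its class with a light universal one, so only pairs of classes without heavy
   vertices matter, and on those [b] and [j0] are twins. *)
Lemma kernel_pair :
  ~ {in R &, forall x y, x != y -> q x y} ->
  exists (g' : 'I_n -> T) a b,
    [/\ classes_adjacent R q g', g' @: R = g @: R,
       a \in kernel, b \in kernel & a != b /\ g' a = g' b].
Proof.
move=> ncomp.
have JP x y : x \in light_universal -> y \in R -> y \notin heavy -> x != y -> q x y.
  rewrite inE => /and3P[xR xh /forallP/(_ y)/implyP xy] yR yh neq.
  by apply: xy; rewrite yR yh eq_sym.
have JR x : x \in light_universal -> x \in R by rewrite inE => /andP[].
have Jh x : x \in light_universal -> x \notin heavy by rewrite inE => /and3P[].
have KJ x : x \in R -> x \notin light_universal -> x \in kernel.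
  by move=> xR xJ; rewrite inE xR (negPf xJ).
have hJ x : x \in heavy -> x \notin light_universal.
  by apply: contraL; apply: Jh.
have hR x : x \in heavy -> x \in R by rewrite inE => /andP[].
case: (boolP [exists a : 'I_n, exists b : 'I_n,
   [&& a \in kernel, b \in kernel, a != b & g a == g b]]).
  case/existsP=> a /existsP[b /and4P[aK bK ab /eqP gab]].
  by exists g, a, b.
move=> nK.
(* All vertices of [R] that are not light universal lie in the kernel, so by [nK] such a vertex is
   merged only with light universal ones. *)
have tJ a : a \in touched -> a \notin light_universal ->
    exists2 b, b \in light_universal & b != a /\ g b = g a.
  move=> /touchedP[aR [b [bR ba gba]]] aJ; exists b => //.
  apply: contraNT nK => bJ; apply/existsP; exists a; apply/existsP; exists b.
  by rewrite !KJ // eq_sym ba gba eqxx.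
(* Take a heavy vertex if there is one; otherwise take a non-adjacent pair, neither end of which is
   light universal and one end of which is touched. *)
have [a aT aJ] : exists2 a, a \in touched & a \notin light_universal.
  case: (set_0Vmem heavy) => [h0|[a ah]]; last first.
    by exists a; [apply: heavy_touched|apply: hJ].
  have [/= u [v [uR vR uv quv]]] : exists u v, [/\ u \in R, v \in R, u != v & ~~ q u v].
    case: (boolP [exists u : 'I_n, exists v : 'I_n, [&& u \in R, v \in R, u != v & ~~ q u v]]).
      by case/existsP=> u /existsP[v /and4P[*]]; exists u, v.
    move=> /existsPn nuv; case: ncomp => u v uR vR uv.
    by have /existsPn/(_ v) := nuv u; rewrite uR vR uv /= negbK.
  have nJ x y : y \in R -> x != y -> ~~ q x y -> x \notin light_universal.
    by move=> yR xy; apply: contra => xJ; apply: JP; rewrite // h0 inE.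
  case: (boolP (u \in touched)) => uT; first by exists u => //; apply: nJ quv.
  exists v; first exact: nonadjacent_touched quv uT.
  by apply: (nJ _ u); rewrite // 1?eq_sym // q_sym.
have [b bJ [ba gba]] := tJ _ aT aJ.
(* This is the light universal vertex that the kernel keeps. The involution [s] below exchanges it
   with [b], and is the identity if they coincide. *)
pose j0 := [arg min_(i < b | i \in light_universal) (i : nat)].
have [j0J j0min] : j0 \in light_universal /\
    forall i, i \in light_universal -> j0 <= i.
  by rewrite /j0; case: arg_minnP.
have j0K : j0 \in kernel.
  rewrite inE JR //= j0J /=; apply/existsPn => y; apply/negP=> /andP[yJ].
  by rewrite ltnNge j0min.
pose s x := if x == b then j0 else if x == j0 then b else x.
have sb : s b = j0 by rewrite /s eqxx.
have sj : s j0 = b by rewrite /s eqxx; case: eqP.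
have sx x : x != b -> x != j0 -> s x = x.
  by rewrite /s => /negPf -> /negPf ->.
have sK : involutive s.
  move=> x; case: (eqVneq x b) => [->|xb]; first by rewrite sb sj.
  by case: (eqVneq x j0) => [->|xj]; [rewrite sj sb|rewrite !sx].
have sR x : (s x \in R) = (x \in R).
  case: (eqVneq x b) => [->|xb]; first by rewrite sb !JR.
  by case: (eqVneq x j0) => [->|xj]; [rewrite sj !JR|rewrite sx].
have sJ x : (s x \in light_universal) = (x \in light_universal).
  case: (eqVneq x b) => [->|xb]; first by rewrite sb j0J bJ.
  by case: (eqVneq x j0) => [->|xj]; [rewrite sj j0J bJ|rewrite sx].
exists (g \o s), a, j0; split=> //; last 1 first.
- have aj : a != j0 by apply: contraNneq aJ => ->.
  by split=> //=; rewrite sj sx // eq_sym.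
- move=> x y xR yR; rewrite /= => gxy.
  (* Each class has a light member, and a class containing a heavy vertex has
     a light universal one. *)
  have cls z : z \in R -> (exists2 w, w \in light_universal & g (s w) = g (s z)) \/
      (forall w, w \in R -> g w = g (s z) -> w \notin heavy).
    move=> zR; case: (boolP [exists w in heavy, g w == g (s z)]).
      case/exists_inP=> h hh /eqP gh.
      have [w wJ [_ gw]] := tJ h (heavy_touched hh) (hJ _ hh).
      by left; exists (s w); rewrite ?sJ // sK gw.
    move=> /exists_inPn nh; right=> w wR gw; apply/negP => wh.
    by have := nh _ wh; rewrite gw eqxx.
  have lgt z : z \in R -> exists w, [/\ w \in R, w \notin heavy & g (s w) = g (s z)].
    move=> zR; case: (cls z zR) => [[w wJ gw]|nh].
      by exists w; rewrite JR ?Jh.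
    exists z; split=> //.
    case: (boolP (z \in light_universal)) => [/Jh //|zJ].
    have <- : s z = z by apply: sx; apply: contraNneq zJ => ->.
    by apply: nh; rewrite ?sR.
  (* A light universal member of one class is adjacent to a light member of the other. *)
  have Jx z z' : z \in R -> z' \in R -> g (s z) != g (s z') ->
      (exists2 w, w \in light_universal & g (s w) = g (s z)) ->
      exists w w', [/\ w \in R, w' \in R, g (s w) = g (s z), g (s w') = g (s z') & q w w'].
    move=> zR z'R gz [w wJ gw]; have [w' [w'R w'h gw']] := lgt z' z'R.
    exists w, w'; split=> //; first exact: JR.
    by apply: JP => //; apply: contraNneq gz => ww; rewrite -gw ww gw'.
  case: (boolP [exists w in light_universal, g (s w) == g (s x)]).
    by case/exists_inP=> w wJ /eqP gw; apply: Jx => //; exists w.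
  move=> /exists_inPn nx.
  case: (boolP [exists w in light_universal, g (s w) == g (s y)]).
    case/exists_inP=> w wJ /eqP gw.
    have [||||y' [x' [? ? ? ? ?]]] := Jx y x; rewrite // 1?eq_sym //.
      by exists w.
    by exists x', y'; rewrite q_sym.
  move=> /exists_inPn ny.
  (* Neither class contains a light universal vertex, so [s] fixes both ends of the edge provided by
     [g]. *)
  have [||x' [y' [x'R y'R gx gy qxy]]] := g_adj _ _ gxy; rewrite ?sR //.
  have fx z z' : (forall w, w \in light_universal -> g (s w) != g (s z)) ->
      g z' = g (s z) -> s z' = z'.
    move=> nz gz; case: (boolP (z' \in light_universal)) => zJ.
      by have := nz (s z'); rewrite sJ sK gz eqxx => /(_ zJ).
    by apply: sx; apply: contraNneq zJ => ->.
  by exists x', y'; split=> //; rewrite ?(fx _ _ nx gx) ?(fx _ _ ny gy).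
- apply/setP => t; apply/imsetP/imsetP => -[x xR ->].
    by exists (s x); rewrite ?sR.
  by exists (s x); rewrite ?sR //= sK.
- by apply: KJ => //; case/touchedP: aT.
Qed.

End Labelling.

End Kernel.

(** * The guessing algorithm *)

Section Rank.

Variables (n : nat) (S : {set 'I_n}).

Definition rank (x : 'I_n) : nat := #|[set y in S | y < x]|.

(* The element of rank [d], or 0 if there is none. *)
Definition select (d : nat) : nat := \sum_(x in S | rank x == d) x.

Lemma ltn_rank (x y : 'I_n) : x \in S -> x < y -> rank x < rank y.
Proof.
move=> xS xy; apply: proper_card; apply/properP; split.
  by apply/subsetP=> z; rewrite !inE => /andP[-> /ltn_trans->].
by exists x; rewrite !inE xS ?xy ?ltnn.
Qed.

Lemma rank_inj : {in S &, injective rank}.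
Proof.
move=> x y xS yS rxy; apply: val_inj; case: (ltngtP x y) => //= h.
  by have := ltn_rank xS h; rewrite rxy ltnn.
by have := ltn_rank yS h; rewrite rxy ltnn.
Qed.

Lemma rank_lt_card x : x \in S -> rank x < #|S|.
Proof.
move=> xS; apply: proper_card; apply/properP; split.
  by apply/subsetP=> z; rewrite !inE => /andP[].
by exists x; rewrite // inE ltnn andbF.
Qed.

Lemma selectK x : x \in S -> select (rank x) = x.
Proof.
move=> xS; rewrite /select (big_pred1 x) // => y /=.
apply/andP/eqP => [[yS /eqP ryx]|->]; first exact: rank_inj.
by rewrite xS.
Qed.

Lemma select_lt d : 0 < n -> select d < n.
Proof.
move=> n0; case: (pickP [pred x in S | rank x == d]) => [x /= /andP[xS /eqP <-]|none].
  by rewrite selectK.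
by rewrite /select big_pred0.
Qed.

End Rank.

Section Algorithm.

Variables (n k : nat) (A : rel 'I_n).
Hypothesis A_sym : symmetric A.

(** If [f] is idempotent, its fixed points form a system of representatives of the classes. *)
Definition reps (f : 'I_n -> 'I_n) := [set x | f x == x].

(** Labels are compared as numbers because the machine holds them in registers. *)
Definition quotient_adj (f : 'I_n -> 'I_n) (x y : nat) : bool :=
  [exists x' : 'I_n, exists y' : 'I_n,
     [&& f x' == x :> nat, f y' == y :> nat & A x' y']].

Definition candidates (f : 'I_n -> 'I_n) : {set 'I_n} :=
  kernel k (reps f) (fun x y => quotient_adj f x y).

Definition relabel (a b : nat) (x : 'I_n) : 'I_n :=
  if x == a :> nat then insubd x b else x.

(** If a solution exists, this bounds the number of candidates, so that their ranks are digits in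
    this base. *)
Definition base : nat := (2 * k + 1) ^ 2.

(** The two lowest digits of [Q] are the ranks of the candidates to merge. A rank that no candidate
    has selects 0; this is harmless, as any step loses at most one label and acceptance is tested at
    the end. *)
Definition guess_step (Qf : nat * ('I_n -> 'I_n)) : nat * ('I_n -> 'I_n) :=
  let: (Q, f) := Qf in
  (Q %/ base %/ base,
   relabel (select (candidates f) (Q %% base))
           (select (candidates f) (Q %/ base %% base)) \o f).

Definition accepting (f : 'I_n -> 'I_n) : bool :=
  [forall x : 'I_n, forall y : 'I_n, (f x != f y) ==> quotient_adj f (f x) (f y)].

Lemma quotient_adjP f (x y : 'I_n) :
  reflect (exists x' y', [/\ f x' = x, f y' = y & A x' y']) (quotient_adj f x y).
Proof.
apply: (iffP existsP) => [[x' /existsP[y' /and3P[/eqP/val_inj ? /eqP/val_inj ? ?]]]|].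
  by exists x', y'.
case=> x' [y' [<- <- Axy]]; exists x'; apply/existsP; exists y'.
by rewrite !eqxx.
Qed.

Lemma quotient_adj_sym f (x y : 'I_n) : quotient_adj f x y = quotient_adj f y x.
Proof.
by apply/quotient_adjP/quotient_adjP => -[x' [y' [*]]]; exists y', x'; rewrite A_sym.
Qed.

Lemma acceptingP f : reflect (classes_adjacent setT A f) (accepting f).
Proof.
apply: (iffP forallP) => [acc x y _ _ fxy|adj x].
  have /forallP/(_ y)/implyP/(_ fxy)/quotient_adjP[x' [y' [? ? ?]]] := acc x.
  by exists x', y'.
apply/forallP=> y; apply/implyP=> fxy.
have [x' [y' [_ _ ? ? ?]]] := adj x y (in_setT _) (in_setT _) fxy.
by apply/quotient_adjP; exists x', y'.
Qed.

(** Only the label [a] can disappear. *)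
Lemma card_relabel a b (f : 'I_n -> 'I_n) :
  #|f @: setT| <= #|(relabel a b \o f) @: setT| + 1.
Proof.
rewrite -(cardsID [set y : 'I_n | y == a :> nat] (f @: setT)) addnC leq_add //.
  apply: subset_leq_card; apply/subsetP=> y; rewrite !inE => /andP[ya /imsetP[x _ yE]].
  by apply/imsetP; exists x => //=; rewrite -yE /relabel (negPf ya).
apply/card_le1_eqP => x y; rewrite !inE => /andP[_ /eqP xa] /andP[_ /eqP ya].
by apply: val_inj; rewrite /= xa.
Qed.

(** Merging vertices of a complete quotient keeps it complete, so steps left over after a solution
    is reached do no harm. *)
Lemma accepting_relabel a b f : accepting f -> accepting (relabel a b \o f).
Proof.
move=> /acceptingP adj; apply/acceptingP => x y _ _ /= rxy.
have [|x' [y' [_ _ fx fy Axy]]] := adj x y (in_setT _) (in_setT _).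
  by apply: contraNneq rxy => ->.
by exists x', y'; rewrite fx fy.
Qed.

Lemma accepting_iter i Q f : accepting f -> accepting (iter i guess_step (Q, f)).2.
Proof.
move=> acc; elim: i => [//|i IH] /=.
by case: (iter _ _ _) IH => Q' f' /= IH; apply: accepting_relabel.
Qed.

Lemma card_iter i Q f :
  #|f @: setT| <= #|(iter i guess_step (Q, f)).2 @: setT| + i.
Proof.
elim: i => [|i IH] /=; first by rewrite addn0.
case: (iter _ _ _) IH => Q' f' /= IH.
by apply: leq_trans IH _; rewrite addnS -addSn leq_add2r -addn1 card_relabel.
Qed.

(** [g] describes the merges still to be made on the representatives of [f], and [j] is the
    remaining budget. *)
Definition solvable (j : nat) (f : 'I_n -> 'I_n) : Prop :=
  (forall x, f (f x) = f x) /\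
  exists (T : finType) (g : 'I_n -> T),
    classes_adjacent (reps f) (fun x y => quotient_adj f x y) g /\
    #|reps f| <= #|g @: reps f| + j.

(** The vertex [a] ceases to be a representative while [b] keeps their common label: [g] has the
    same image on one representative fewer, which pays for the smaller budget. *)
Lemma solvable_relabel j f (T : finType) (g : 'I_n -> T) a b :
  (forall x, f (f x) = f x) ->
  classes_adjacent (reps f) (fun x y => quotient_adj f x y) g ->
  #|reps f| <= #|g @: reps f| + j.+1 ->
  a \in reps f -> b \in reps f -> a != b -> g a = g b ->
  solvable j (relabel a b \o f).
Proof.
move=> ff adj card aR bR ab gab.
have rE x : relabel a b x = if x == a then b else x.
  by rewrite /relabel -val_eqE; case: eqP => // _; apply: val_inj; rewrite val_insubd ltn_ord.
have bE : relabel a b b = b by rewrite rE; case: eqP.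
have fa : f a = a by move: aR; rewrite inE => /eqP.
have fb : f b = b by move: bR; rewrite inE => /eqP.
have fr x : f (relabel a b (f x)) = relabel a b (f x) by rewrite rE; case: eqP.
have RE : reps (relabel a b \o f) = reps f :\ a.
  apply/setP => x; rewrite !inE /= rE; case: (eqVneq x a) => [->|xa] /=.
    by rewrite fa eqxx eq_sym (negPf ab).
  case: (eqVneq (f x) a) => [fxa|//]; rewrite ?fxa [a == x]eq_sym (negPf xa).
  by apply/eqP => bx; move: fxa; rewrite -bx fb => /eqP; rewrite eq_sym (negPf ab).
have gr x : g (relabel a b x) = g x by rewrite rE; case: eqP => // ->.
split=> [x|]; first by rewrite /= fr rE; case: eqP => //; rewrite rE; case: eqP.
exists T, g; rewrite RE; split.
  move=> x y /setD1P[_ xR] /setD1P[_ yR] /(adj _ _ xR yR).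
  case=> x' [y' [x'R y'R <- <- /quotient_adjP[x2 [y2 [x2E y2E A2]]]]].
  have mem z : z \in reps f -> relabel a b z \in reps f :\ a.
    move=> zR; rewrite in_setD1 rE; case: (eqVneq z a) => [_|za]; last by rewrite za.
    by rewrite eq_sym ab.
  exists (relabel a b x'), (relabel a b y'); rewrite !mem // !gr; split=> //.
  by apply/quotient_adjP; exists x2, y2; rewrite /= x2E y2E.
have <- : g @: reps f = g @: (reps f :\ a).
  apply/setP=> t; apply/imsetP/imsetP=> -[x xR ->]; last first.
    by exists x => //; case/setD1P: xR.
  case: (eqVneq x a) => [->|xa]; last by exists x => //; rewrite in_setD1 xa.
  by exists b => //; rewrite in_setD1 bR eq_sym ab.
by move: card; rewrite (cardsD1 a) aR addnS add1n ltnS.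
Qed.

Lemma base_gt0 : 0 < base.
Proof. by rewrite expn_gt0 addn1. Qed.

Lemma accepting_complete f : (forall x, f (f x) = f x) ->
  {in reps f &, forall x y : 'I_n, x != y -> quotient_adj f x y} -> accepting f.
Proof.
move=> ff comp; apply/forallP=> x; apply/forallP=> y; apply/implyP=> fxy.
by apply: comp; rewrite // inE ff.
Qed.

(** Completeness of guessing: [kernel_pair] supplies two candidates whose merge lowers the budget by
    one, and [j <= k] makes the kernel bound available at every stage. *)
Lemma solvable_guess j f : solvable j f -> j <= k ->
  exists2 N, N < (base * base) ^ j & accepting (iter j guess_step (N, f)).2.
Proof.
elim: j f => [|j IH] f [ff [T [g [adj card]]]] jk.
  (* No merge is left, so [g] is injective on the representatives. *)
  exists 0 => //; apply: accepting_complete => // x y xR yR xy.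
  have /imset_injP gi : #|g @: reps f| == #|reps f|.
    by rewrite eqn_leq leq_imset_card -[#|g @: _|]addn0.
  have [|x' [y' [x'R y'R /gi-> // /gi-> //]]] := adj x y xR yR.
  by apply: contraNneq xy => /gi ->.
case: (boolP (accepting f)) => [acc|/negP nacc].
  exists 0; last exact: accepting_iter.
  by rewrite expn_gt0 muln_gt0 base_gt0.
have ncomp : ~ {in reps f &, forall x y : 'I_n, x != y -> quotient_adj f x y}.
  by move=> comp; apply: nacc; apply: accepting_complete.
have qs : symmetric (fun x y : 'I_n => quotient_adj f x y).
  by move=> x y; apply: quotient_adj_sym.
have [g' [a [b [adj' im aK bK [ab gab]]]]] := kernel_pair qs adj card jk ncomp.
have cK := card_kernel qs adj card jk.
have KR x : x \in candidates f -> x \in reps f by rewrite inE => /andP[].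
have card' : #|reps f| <= #|g' @: reps f| + j.+1 by rewrite im.
have [N Nlt Nacc] :=
  IH _ (solvable_relabel ff adj' card' (KR _ aK) (KR _ bK) ab gab) (ltnW jk).
have ra : rank (candidates f) a < base by apply: leq_trans (rank_lt_card aK) cK.
have rb : rank (candidates f) b < base by apply: leq_trans (rank_lt_card bK) cK.
(* The ranks of [a] and [b] become the two lowest digits, below the digits of the later steps. *)
exists ((N * base + rank (candidates f) b) * base + rank (candidates f) a).
  rewrite expnS; move: Nlt; set X := _ ^ j; move: ra rb; clear; nia.
rewrite iterSr /=.
by rewrite !(divnMDl, modnMDl, divn_small ra, modn_small ra, divn_small rb, modn_small rb,
  addn0) ?base_gt0 // !selectK.
Qed.

End Algorithm.

Definition index_adj (G : sgraph) : rel 'I_#|G| :=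
  fun i j => adj (enum_val i) (enum_val j).

(** An accepting guess yields a clique because [card_iter] bounds the lost labels, whatever was
    guessed. Conversely, a sequence of identifications makes the identity labelling solvable with
    budget [k]. *)
Lemma clique_identificationP (G : sgraph) k :
  clique_identification G k <->
  exists2 N, N < (base k * base k) ^ k &
    accepting (@index_adj G) (iter k (guess_step k (@index_adj G)) (N, id)).2.
Proof.
have A_sym : symmetric (@index_adj G) by move=> i j; apply: adj_sym.
split=> [[m [H [mk iH cH]]]|[N _ /acceptingP acc]]; last first.
  set f := (iter _ _ _).2 in acc.
  apply: (@labelling_clique_identification _ _ _ (f \o enum_rank)).
    move=> x y _ _ /= fxy; have [i [j [_ _ fi fj Aij]]] := acc _ _ (in_setT _) (in_setT _) fxy.
    by exists (enum_val i), (enum_val j); rewrite /= !enum_valK; split.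
  have -> : (f \o enum_rank) @: setT = f @: setT.
    rewrite imset_comp; suff -> : enum_rank @: setT = [set: 'I_#|G|] by [].
    apply/setP=> i; rewrite inE.
    by apply/imsetP; exists (enum_val i); rewrite ?enum_valK.
  have := card_iter k (@index_adj G) k N id; rewrite -/f imset_id cardsT card_ord; exact.
apply: solvable_guess => //; split=> //.
have [phi [cG im aphi]] := identifications_labelling iH.
have RT : reps (@id 'I_#|G|) = setT by apply/setP=> x; rewrite !inE eqxx.
exists H, (phi \o enum_val); rewrite RT; split.
  move=> i j _ _ /= pij; have [x [y [px py xy]]] := aphi _ _ (cH _ _ pij).
  exists (enum_rank x), (enum_rank y); rewrite /= !enum_rankK; split=> //.
  apply/quotient_adjP; exists (enum_rank x), (enum_rank y).
  by rewrite /index_adj !enum_rankK.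
have -> : (phi \o enum_val) @: [set: 'I_#|G|] = phi @: setT.
  rewrite imset_comp; suff -> : enum_val @: [set: 'I_#|G|] = [set: G] by [].
  apply/setP=> x; rewrite inE.
  by apply/imsetP; exists (enum_rank x); rewrite ?enum_rankK.
by rewrite cardsT card_ord cG leq_add2l.
Qed.

(** * The program *)

(* Registers: 0 = n, 1 = k, 2 = n^2, 3 = base, 4 = number of guesses, 5 = number of
   accepting guesses, 6 = current guess, 7 = its digits left to read, 8 and 9 = labels
   to merge, 10 to 29 = indices and temporaries. The label of vertex z is stored in
   memory cell n^2 + z. *)
Definition ENot e := ESub (EConst 1) e.
Definition EAnd a b := ENot (EAdd (ENot a) (ENot b)).
Definition EEq a b := ENot (EAdd (ESub a b) (ESub b a)).
Definition ELt a b := ESub b a.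
Definition EBool e := ENot (ENot e).
Definition EEx v e := ESum v 0 e.
Definition ECount v e := ESum v 0 (EBool e).
(* Index 12 is a dummy: no expression reads register 12. *)
Definition EMul u e := ESum 12 u e.

(** Every nonzero value counts as true: [ELt] and [EEx] may return any positive number, and [EBool]
    normalizes to 0 or 1 where the value is counted or multiplied. *)
Definition holds r m e : bool := eval r m e != 0.

Lemma holds_not r m e : holds r m (ENot e) = ~~ holds r m e.
Proof. by rewrite /holds /=; case: (eval r m e). Qed.

Lemma holds_and r m a b : holds r m (EAnd a b) = holds r m a && holds r m b.
Proof. by rewrite /holds /=; case: (eval r m a) => [|x]; case: (eval r m b). Qed.

Lemma eval_eq r m a b : eval r m (EEq a b) = (eval r m a == eval r m b).
Proof. rewrite /=; case: ltngtP => ?; lia. Qed.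

Lemma holds_eq r m a b : holds r m (EEq a b) = (eval r m a == eval r m b).
Proof. by rewrite /holds eval_eq eqb0 negbK. Qed.

Lemma holds_lt r m a b : holds r m (ELt a b) = (eval r m a < eval r m b).
Proof. by rewrite /holds /= subn_eq0 ltnNge. Qed.

Lemma eval_bool r m e : eval r m (EBool e) = holds r m e.
Proof. by rewrite /holds /=; case: (eval r m e). Qed.

Lemma eval_mul r m u e c :
  (forall i, eval (upd r 12 i) m e = c) -> eval r m (EMul u e) = r u * c.
Proof.
move=> h /=; rewrite (eq_bigr (fun=> c)) => [|i _]; last exact: h.
by rewrite sum_nat_const card_ord.
Qed.

Lemma eval_sum0 n r m v e (F : 'I_n -> nat) :
  r 0 = n -> (forall i : 'I_n, eval (upd r v i) m e = F i) ->
  eval r m (ESum v 0 e) = \sum_(i < n) F i.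
Proof.
move=> r0 h /=; rewrite -(big_mkord xpredT (fun i => eval (upd r v i) m e)) r0 big_mkord.
by apply: eq_bigr => i _; rewrite h.
Qed.

Lemma holds_ex n r m v e (p : pred 'I_n) :
  r 0 = n -> (forall i : 'I_n, holds (upd r v i) m e = p i) ->
  holds r m (EEx v e) = [exists i, p i].
Proof.
move=> r0 h; rewrite /holds (eval_sum0 r0 (fun i => erefl)) sum_nat_eq0 negb_forall.
by apply: eq_existsb => i /=; rewrite -h.
Qed.

Lemma eval_count n r m v e (p : pred 'I_n) :
  r 0 = n -> (forall i : 'I_n, holds (upd r v i) m e = p i) ->
  eval r m (ECount v e) = #|[set i | p i]|.
Proof.
move=> r0 h; rewrite (eval_sum0 (F := fun i => nat_of_bool (p i)) r0); last first.
  by move=> i; rewrite eval_bool h.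
by rewrite -sum1dep_card [RHS]big_mkcond; apply: eq_bigr => i _; case: (p i).
Qed.

(** In the formulas below, bound indices grow with the nesting, and arguments sit in registers above
    the indices bound inside, so that no variable is captured. *)
Definition ELabel x := EMem (EAdd (EVar 2) (EVar x)).
Definition EAdj x y := EMem (EAdd (EMul x (EVar 0)) (EVar y)).
Definition EQuot ex ey :=
  EEx 14 (EEx 15 (EAnd (EEq (ELabel 14) ex)
                       (EAnd (EEq (ELabel 15) ey) (EAdj 14 15)))).
Definition ERep x := EEq (ELabel x) (EVar x).
Definition EHeavy x :=
  EAnd (ERep x)
    (ELt (EAdd (EVar 1) (EVar 1))
       (ECount 16 (EAnd (ERep 16)
          (EAnd (ENot (EEq (EVar 16) (EVar x))) (ENot (EQuot (EVar x) (EVar 16))))))).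
Definition ELightUniversal x :=
  EAnd (ERep x) (EAnd (ENot (EHeavy x))
    (ENot (EEx 17 (EAnd
       (EAnd (ERep 17) (EAnd (ENot (EHeavy 17)) (ENot (EEq (EVar 17) (EVar x)))))
       (ENot (EQuot (EVar x) (EVar 17))))))).
Definition ECandidate x :=
  EAnd (ERep x) (ENot (EAnd (ELightUniversal x)
    (EEx 18 (EAnd (ELightUniversal 18) (ELt (EVar 18) (EVar x)))))).
Definition ERank x := ECount 19 (EAnd (ECandidate 19) (ELt (EVar 19) (EVar x))).
Definition ESelect d :=
  ESum 20 0 (EMul 20 (EBool (EAnd (ECandidate 20) (EEq (ERank 20) (EVar d))))).
Definition EAccept :=
  ENot (EEx 21 (EEx 22 (EAnd (ENot (EEq (ELabel 21) (ELabel 22)))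
                             (ENot (EQuot (ELabel 21) (ELabel 22)))))).
(** The quotient is the number of [i] such that [i + 1] times the divisor fits into the dividend. *)
Definition EDiv q b :=
  ESum 23 q (EBool (ENot (ELt (EVar q) (EMul b (EAdd (EVar 23) (EConst 1)))))).

(** * Meaning of the expressions of the program *)

Section Expressions.

Variables (n k : nat) (A : rel 'I_n) (f : 'I_n -> 'I_n).

Definition env (r : nat -> nat) := [/\ r 0 = n, r 1 = k & r 2 = n * n].
Definition graph_in (m : nat -> nat) := forall x y : 'I_n, m (x * n + y) = A x y.
Definition labels_in (g : 'I_n -> 'I_n) (m : nat -> nat) :=
  forall x : 'I_n, m (n * n + x) = g x.

Variable m : nat -> nat.
Hypotheses (mA : graph_in m) (mf : labels_in f m).

Lemma env_upd r v i : 2 < v -> env r -> env (upd r v i).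
Proof. by case: v => [|[|[|v]]] // _ [*]; split. Qed.

Lemma eval_label r x (X : 'I_n) : env r -> r x = X -> eval r m (ELabel x) = f X.
Proof. by case=> _ _ r2 rx; rewrite /= r2 rx mf. Qed.

Lemma holds_adj r x y (X Y : 'I_n) : env r -> x != 12 -> y != 12 ->
  r x = X -> r y = Y -> holds r m (EAdj x y) = A X Y.
Proof.
move=> [r0 _ _] x12 y12 rx ry; rewrite /holds /EAdj.
have -> : eval r m (EMem (EAdd (EMul x (EVar 0)) (EVar y)))
   = m (eval r m (EMul x (EVar 0)) + r y) by [].
by rewrite (@eval_mul _ _ _ _ n) // rx ry mA; case: (A X Y).
Qed.

(** The two constancy hypotheses express that [ex] and [ey] do not depend on the bound indices 14
    and 15. *)
Lemma holds_quot r ex ey (X Y : nat) : env r ->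
  (forall i j, eval (upd (upd r 14 i) 15 j) m ex = X) ->
  (forall i j, eval (upd (upd r 14 i) 15 j) m ey = Y) ->
  holds r m (EQuot ex ey) = quotient_adj A f X Y.
Proof.
move=> er hx hy; have [r0 _ _] := er.
apply: holds_ex => // i; apply: holds_ex => // j.
have er' : env (upd (upd r 14 i) 15 j) by do 2!apply: env_upd => //.
rewrite !holds_and !holds_eq hx hy.
by rewrite (@eval_label _ _ i) // (@eval_label _ _ j) // (@holds_adj _ _ _ i j).
Qed.

Lemma holds_rep r x (X : 'I_n) : env r -> r x = X ->
  holds r m (ERep x) = (X \in reps f).
Proof. by move=> er rx; rewrite holds_eq (eval_label er rx) /= rx inE. Qed.

Lemma holds_quot_var r x y (X Y : 'I_n) : env r -> 15 < x -> 15 < y ->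
  r x = X -> r y = Y -> holds r m (EQuot (EVar x) (EVar y)) = quotient_adj A f X Y.
Proof. by move=> er x15 y15 rx ry; apply: holds_quot => // i j; upds. Qed.

Local Notation q := (fun x y : 'I_n => quotient_adj A f x y).

Lemma holds_heavy r x (X : 'I_n) : env r -> 16 < x -> r x = X ->
  holds r m (EHeavy x) = (X \in heavy k (reps f) q).
Proof.
move=> er x16 rx; have [r0 r1 _] := er.
rewrite holds_and (holds_rep er rx) [in RHS]inE holds_lt; congr (_ && _).
rewrite (@eval_count n _ _ _ _ (fun y => (y \in reps f) && ((y != X) && ~~ q X y))) //.
  by rewrite /= r1 mul2n addnn.
move=> i; have er' : env (upd r 16 i) by apply: env_upd.
have rx' : upd r 16 i x = X by upds.
rewrite 2!holds_and (@holds_rep _ _ i) // holds_not holds_eq holds_not.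
rewrite (@holds_quot_var _ _ _ X i) //; last lia.
by rewrite [eval _ _ (EVar x)]rx' /=.
Qed.

Lemma holds_light_universal r x (X : 'I_n) : env r -> 17 < x -> r x = X ->
  holds r m (ELightUniversal x) = (X \in light_universal k (reps f) q).
Proof.
move=> er x17 rx; have [r0 r1 _] := er.
rewrite 2!holds_and (holds_rep er rx) holds_not (@holds_heavy _ _ X) ?(ltnW x17) // holds_not.
rewrite [in RHS]inE; congr [&& _, _ & _].
rewrite (@holds_ex n _ _ _ _ (fun y => [&& y \in reps f, y \notin heavy k (reps f) q & y != X]
   && ~~ q X y)) //.
  by rewrite negb_exists; apply: eq_forallb => y; rewrite negb_and negbK implybE.
move=> i; have er' : env (upd r 17 i) by apply: env_upd.
have rx' : upd r 17 i x = X by upds.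
rewrite 3!holds_and (@holds_rep _ _ i) // holds_not (@holds_heavy _ _ i) // holds_not.
rewrite holds_eq holds_not (@holds_quot_var _ _ _ X i) //; last lia.
by rewrite [eval _ _ (EVar x)]rx' /=.
Qed.

Lemma holds_candidate r x (X : 'I_n) : env r -> 18 < x -> r x = X ->
  holds r m (ECandidate x) = (X \in candidates k A f).
Proof.
move=> er x18 rx; have [r0 r1 _] := er.
rewrite holds_and (holds_rep er rx) holds_not holds_and.
rewrite (@holds_light_universal _ _ X) ?(ltnW x18) //.
rewrite [in RHS]inE; congr (_ && ~~ (_ && _)).
apply: holds_ex => // i; have er' : env (upd r 18 i) by apply: env_upd.
have rx' : upd r 18 i x = X by upds.
by rewrite holds_and (@holds_light_universal _ _ i) // holds_lt [eval _ _ (EVar x)]rx' /=.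
Qed.

Lemma eval_rank r x (X : 'I_n) : env r -> 19 < x -> r x = X ->
  eval r m (ERank x) = rank (candidates k A f) X.
Proof.
move=> er x19 rx; have [r0 r1 _] := er.
apply: eval_count => // i; have er' : env (upd r 19 i) by apply: env_upd.
have rx' : upd r 19 i x = X by upds.
by rewrite holds_and (@holds_candidate _ _ i) // holds_lt [eval _ _ (EVar x)]rx' /=.
Qed.

Lemma eval_select r d : env r -> d != 12 -> d != 20 ->
  eval r m (ESelect d) = select (candidates k A f) (r d).
Proof.
move=> er d12 d20; have [r0 r1 _] := er.
rewrite /select [RHS]big_mkcond; apply: eval_sum0 => // i.
have er' j : env (upd (upd r 20 i) 12 j) by do 2!apply: env_upd => //.
rewrite (@eval_mul _ _ _ _
  ((i \in candidates k A f) && (rank (candidates k A f) i == r d))) => [|j].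
  by rewrite /=; case: (_ && _); rewrite ?muln0 ?muln1.
rewrite eval_bool holds_and (@holds_candidate _ _ i) // holds_eq (@eval_rank _ _ i) //.
by rewrite /= !updE (negPf d12) (negPf d20).
Qed.

Lemma eval_accept r : env r -> eval r m EAccept = accepting A f.
Proof.
move=> er; have [r0 r1 _] := er.
have -> : eval r m EAccept = holds r m EAccept.
  by rewrite /holds /EAccept /ENot /=; case: (\sum_(_ < _) _).
rewrite holds_not; congr nat_of_bool.
rewrite (@holds_ex n _ _ _ _ (fun x => [exists y : 'I_n, (f x != f y) &&
    ~~ quotient_adj A f (f x) (f y)])) // => [|i].
  rewrite negb_exists; apply: eq_forallb => x; rewrite negb_exists.
  by apply: eq_forallb => y; rewrite negb_and !negbK implybE negbK.
apply: holds_ex => // j.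
have er' : env (upd (upd r 21 i) 22 j) by do 2!apply: env_upd => //.
rewrite holds_and holds_not holds_eq holds_not (@eval_label _ _ i) // (@eval_label _ _ j) //.
congr (_ && ~~ _); apply: holds_quot => // i' j'.
  by apply: eval_label => //; do 2!apply: env_upd => //.
by apply: eval_label => //; do 2!apply: env_upd => //.
Qed.

End Expressions.

Lemma eval_div r m q b : q < 12 -> b < 12 -> 0 < r b ->
  eval r m (EDiv q b) = r q %/ r b.
Proof.
move=> q12 b12 b0; rewrite /EDiv; set e := EBool _.
have eE i : eval (upd r 23 i) m e = (i < r q %/ r b).
  rewrite eval_bool holds_not holds_lt -leqNgt leq_divRL // mulnC.
  rewrite (@eval_mul _ _ _ _ i.+1) => [|j]; last by rewrite /= !updE /= addn1.
  by rewrite /= !updE !ifN // neq_ltn; apply/orP; left; lia.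
(* Summing up to the dividend is enough, as the quotient does not exceed it. *)
suff sum_lt N d : \sum_(i < N) (i < d) = minn d N.
  rewrite /= (eq_bigr _ (fun (i : 'I_(r q)) _ => eE i)) sum_lt.
  by apply/minn_idPl; apply: leq_div.
elim: N => [|N IH]; first by rewrite big_ord0 minn0.
by rewrite big_ord_recr /= IH; lia.
Qed.

(** An invariant rule giving the final state and the bound on registers in one induction, since the
    bound follows from the invariant. *)
Lemma for_ind M v u s st (Inv : nat -> state -> Prop) :
  Inv 0 st ->
  (forall i st', i < st.1 u -> Inv i st' ->
     Inv i.+1 (sem s (set_reg v st' i)) /\ bounded_run M s (set_reg v st' i)) ->
  Inv (st.1 u) (sem (SFor v u s) st) /\ bounded_run M (SFor v u s) st.
Proof.
move=> inv0 invS /=; set F := fun st' i => _.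
have inv i : i <= st.1 u -> Inv i (foldl F st (iota 0 i)).
  elim: i => [//|i IH] iu; rewrite -addn1 iotaD foldl_cat addn1.
  exact: (invS i _ iu (IH (ltnW iu))).1.
split=> [|i iu]; first exact: inv.
exact: (invS i _ iu (inv i (ltnW iu))).2.
Qed.

Lemma bounded_set M v e st x :
  eval st.1 st.2 e = x -> x <= M -> bounded_run M (SSet v e) st.
Proof. by move=> <-. Qed.

Definition SWriteLabels e := SFor 11 0 (SWrite (EAdd (EVar 2) (EVar 11)) e).

(** A conditional without branches: the product with the truth value of the test exchanges register
    8 for register 9 exactly when the label equals register 8. *)
Definition ERelabel :=
  EAdd (ESub (ELabel 11) (EMul 8 (EEq (ELabel 11) (EVar 8))))
       (EMul 9 (EEq (ELabel 11) (EVar 8))).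

Definition SDigit d := SSeq (SSet 13 (EDiv 7 3))
  (SSeq (SSet d (ESub (EVar 7) (EMul 3 (EVar 13)))) (SSet 7 (EVar 13))).

Definition SStep :=
  SSeq (SDigit 24) (SSeq (SDigit 25)
    (SSeq (SSet 8 (ESelect 24)) (SSeq (SSet 9 (ESelect 25)) (SWriteLabels ERelabel)))).

Definition SGuess :=
  SSeq (SSet 7 (EVar 6)) (SSeq (SWriteLabels (EVar 11))
    (SSeq (SFor 10 1 SStep) (SSet 5 (EAdd (EVar 5) EAccept)))).

Definition SInit :=
  SSeq (SSet 2 (EMul 0 (EVar 0)))
    (SSeq (SSet 13 (EAdd (EAdd (EVar 1) (EVar 1)) (EConst 1)))
      (SSeq (SSet 3 (EMul 13 (EVar 13)))
        (SSeq (SSet 13 (EMul 3 (EVar 3)))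
          (SSeq (SSet 4 (EConst 1)) (SFor 10 1 (SSet 4 (EMul 4 (EVar 13)))))))).

Definition SMain := SSeq SInit (SSeq (SFor 6 4 SGuess) (SSet 0 (EVar 5))).

(** * Loop invariants of the program *)

Section Statements.

Variables (n k M : nat) (A : rel 'I_n).

(** Labels are overwritten in place: the only memory cell that [e] may rely on is that of the
    current vertex, which still has its old value. All addresses written are at least [n * n], so
    the matrix survives. *)
Lemma write_labels st e (h : 'I_n -> 'I_n) :
  env n k st.1 -> graph_in A st.2 ->
  (forall st' (i : 'I_n), (forall j, j != 11 -> st'.1 j = st.1 j) -> st'.1 11 = i ->
     st'.2 (n * n + i) = st.2 (n * n + i) -> eval st'.1 st'.2 e = h i) ->
  let st' := sem (SWriteLabels e) st in
  [/\ forall j, j != 11 -> st'.1 j = st.1 j, graph_in A st'.2, labels_in h st'.2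
    & bounded_run M (SWriteLabels e) st].
Proof.
move=> [r0 r1 r2] gr he fin.
pose Inv i (st' : state) := [/\ forall j, j != 11 -> st'.1 j = st.1 j, graph_in A st'.2
  & forall z : 'I_n, st'.2 (n * n + z) = if z < i then h z : nat else st.2 (n * n + z)].
have := @for_ind M 11 0 (SWrite (EAdd (EVar 2) (EVar 11)) e) st Inv.
case=> [|i st' i0 [regs gr' lab]|[regs gr' lab] br]; first by split.
  rewrite r0 in i0; pose I := Ordinal i0.
  have regs' j : j != 11 -> (set_reg 11 st' i).1 j = st.1 j.
    by move=> j11; rewrite /= updE (negPf j11) regs.
  have hI : eval (set_reg 11 st' i).1 (set_reg 11 st' i).2 e = h I.
    by apply: he => //; rewrite [LHS](lab I) /= ltnn.
  split=> //; split=> [||z] /=; first exact: regs'.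
    move=> x y; rewrite !updE /= regs // r2 -gr'; case: eqP => // xyE.
    have := ltn_ord x; have := ltn_ord y; move: xyE; clear; nia.
  rewrite !updE /= regs // r2 eqn_add2l lab.
  case: (eqVneq (z : nat) i) => [zi|zi]; last by rewrite ltnS [z <= i]leq_eqVlt (negPf zi).
  rewrite zi ltnSn [eval _ _ e]hI.
  by congr (nat_of_ord (h _)); apply: val_inj; rewrite /= zi.
by rewrite r0 in regs gr' lab; split=> // z; rewrite lab ltn_ord.
Qed.

Lemma digit_correct st d : 13 < d -> 0 < st.1 3 -> st.1 7 <= M ->
  let st' := sem (SDigit d) st in
  [/\ forall j, j != 7 -> j != 13 -> j != d -> st'.1 j = st.1 j,
      st'.1 7 = st.1 7 %/ st.1 3, st'.1 d = st.1 7 %% st.1 3, st'.2 = st.2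
    & bounded_run M (SDigit d) st].
Proof.
move=> d13 b0 QM.
have divE : eval st.1 st.2 (EDiv 7 3) = st.1 7 %/ st.1 3 by apply: eval_div.
have modE r m : r 7 = st.1 7 -> r 3 = st.1 3 -> r 13 = st.1 7 %/ st.1 3 ->
    eval r m (ESub (EVar 7) (EMul 3 (EVar 13))) = st.1 7 %% st.1 3.
  move=> r7 r3 r13; rewrite -[LHS]/(r 7 - eval r m (EMul 3 (EVar 13))).
  rewrite (@eval_mul _ _ _ _ (r 13)) // r7 r3 r13.
  by rewrite {1}(divn_eq (st.1 7) (st.1 3)) mulnC addKn.
rewrite /SDigit -[sem _ _]/(sem (SSet 7 (EVar 13)) (sem (SSet d _)
  (set_reg 13 st (eval st.1 st.2 (EDiv 7 3))))) divE.
rewrite -[sem (SSet d _) _]/(set_reg d _ (eval _ _ _)) modE //.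
split.
- by move=> j j7 j13 jd; rewrite /= !updE (negPf j7) (negPf j13) (negPf jd).
- by rewrite /= !updE /= ifN // neq_ltn d13.
- rewrite /= updE ifN; last by apply/eqP; lia.
  by rewrite updE eqxx.
- by [].
split; first by apply: (bounded_set _ divE); apply: leq_trans (leq_div _ _) QM.
rewrite -[sem _ st]/(set_reg 13 st (eval st.1 st.2 (EDiv 7 3))) divE; split.
  by apply: (bounded_set _ (modE _ _ _ _ _)); rewrite //; apply: leq_trans (leq_mod _ _) QM.
apply: (@bounded_set _ _ _ _ (st.1 7 %/ st.1 3)).
  by rewrite /= updE ifN // neq_ltn d13.
by apply: leq_trans (leq_div _ _) QM.
Qed.

Lemma select_le (S : {set 'I_n}) d : select S d <= n.
Proof.
case: (posnP n) => [n0|n0]; last exact/ltnW/select_lt.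
by rewrite /select big1 // => x _; have := ltn_ord x; rewrite {2}n0.
Qed.

Lemma step_correct st f : env n k st.1 -> st.1 3 = base k ->
  graph_in A st.2 -> labels_in f st.2 -> st.1 7 <= M -> n <= M ->
  let st' := sem SStep st in
  [/\ forall j, j < 7 -> st'.1 j = st.1 j, st'.1 7 = (guess_step k A (st.1 7, f)).1,
      graph_in A st'.2, labels_in (guess_step k A (st.1 7, f)).2 st'.2
    & bounded_run M SStep st].
Proof.
move=> er r3 gr lf QM nM; set B := base k in r3 *.
have B0 : 0 < B by apply: base_gt0.
rewrite /SStep.
set s1 := SDigit 24; set s2 := SDigit 25.
set s3 := SSet 8 _; set s4 := SSet 9 _; set s5 := SWriteLabels _.
set st1 := sem s1 st; set st2 := sem s2 st1; set st3 := sem s3 st2; set st4 := sem s4 st3.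
rewrite -[sem _ _]/(sem s5 st4).
have [|reg1 Q1 d1 m1 b1] := @digit_correct st 24 erefl _ QM; first by rewrite r3.
rewrite -/s1 -/st1 in reg1 Q1 d1 m1 b1.
have r3' : st1.1 3 = B by rewrite reg1.
have Q1M : st1.1 7 <= M by rewrite Q1; apply: leq_trans (leq_div _ _) QM.
have [|reg2 Q2 d2 m2 b2] := @digit_correct st1 25 erefl _ Q1M; first by rewrite r3'.
rewrite -/s2 -/st2 in reg2 Q2 d2 m2 b2.
rewrite Q1 r3 r3' in Q2; rewrite r3 in d1; rewrite Q1 r3 r3' in d2.
have reg12 j : j < 7 -> st2.1 j = st.1 j.
  by move=> j7; rewrite reg2 ?reg1 //; apply/eqP; lia.
have d1' : st2.1 24 = st.1 7 %% B by rewrite reg2.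
have env2 : env n k st2.1 by case: er => *; split; rewrite reg12.
have m2E : st2.2 = st.2 by rewrite m2.
have a3 : eval st2.1 st2.2 (ESelect 24) = select (candidates k A f) (st.1 7 %% B).
  by rewrite -d1'; apply: eval_select; rewrite ?m2E.
have st3E : st3 = set_reg 8 st2 (select (candidates k A f) (st.1 7 %% B)).
  by rewrite -a3.
have env3 : env n k st3.1 by rewrite st3E; apply: env_upd.
have a4 : eval st3.1 st3.2 (ESelect 25) = select (candidates k A f) (st.1 7 %/ B %% B).
  rewrite -d2; have -> : st2.1 25 = st3.1 25 by rewrite st3E.
  by apply: eval_select; rewrite // st3E /= m2E.
have st4E : st4 = set_reg 9 st3 (select (candidates k A f) (st.1 7 %/ B %% B)).
  by rewrite -a4.
have m4E : st4.2 = st.2 by rewrite st4E st3E.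
have env4 : env n k st4.1 by rewrite st4E; apply: env_upd.
have r48 : st4.1 8 = select (candidates k A f) (st.1 7 %% B) by rewrite st4E st3E.
have r49 : st4.1 9 = select (candidates k A f) (st.1 7 %/ B %% B) by rewrite st4E.
have [||| reg5 gr5 lab5 b5] := @write_labels st4 ERelabel (guess_step k A (st.1 7, f)).2.
- exact: env4.
- by rewrite m4E.
- move=> st' i regs' r11 lab; rewrite m4E lf in lab.
  have env' : env n k st'.1 by case: env4 => *; split; rewrite regs'.
  have labE r : env n k r -> r 11 = i -> eval r st'.2 (ELabel 11) = f i.
    by case=> _ _ r2 ri; rewrite /= r2 ri.
  have eqE j : eval (upd st'.1 12 j) st'.2 (EEq (ELabel 11) (EVar 8)) = (f i == st'.1 8 :> nat).
    by rewrite eval_eq labE //; apply: env_upd.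
  rewrite -[LHS]/(eval st'.1 st'.2 (ELabel 11)
       - eval st'.1 st'.2 (EMul 8 (EEq (ELabel 11) (EVar 8)))
       + eval st'.1 st'.2 (EMul 9 (EEq (ELabel 11) (EVar 8)))).
  rewrite labE // !(eval_mul _ eqE) !regs' // r48 r49 /= /relabel.
  (* Then the selected number is a vertex, so [insubd] does not return its default. *)
  have n0 : 0 < n by apply: leq_ltn_trans (ltn_ord i).
  case: eqP => [->|_]; last by rewrite !muln0 subn0 addn0.
  by rewrite !muln1 subnn add0n val_insubd select_lt.
split; [| |exact: gr5|exact: lab5|].
- move=> j j7; rewrite reg5; last by apply/eqP; lia.
  rewrite st4E st3E [LHS]updE ifN; last by apply/eqP; lia.
  rewrite [LHS]updE ifN; last by apply/eqP; lia.
  exact: reg12.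
- by rewrite reg5 // st4E st3E -[LHS]/(st2.1 7) Q2.
- split; first exact: b1.
  split; first exact: b2.
  split; first by apply: (bounded_set _ a3); apply: leq_trans (select_le _ _) nM.
  split; first by apply: (bounded_set _ a4); apply: leq_trans (select_le _ _) nM.
  exact: b5.
Qed.

Lemma guess_correct st : env n k st.1 -> st.1 3 = base k -> graph_in A st.2 ->
  st.1 5 < M -> st.1 6 <= M -> n <= M ->
  let st' := sem SGuess st in
  [/\ forall j, j < 5 -> st'.1 j = st.1 j,
      st'.1 5 = st.1 5 + accepting A (iter k (guess_step k A) (st.1 6, id)).2,
      graph_in A st'.2 & bounded_run M SGuess st].
Proof.
move=> er r3 gr r5M NM nM.
pose st1 := set_reg 7 st (st.1 6).
have env1 : env n k st1.1 by apply: env_upd.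
have [||| reg2 gr2 lab2 b2] := @write_labels st1 (EVar 11) id => //.
set st2 := sem (SWriteLabels (EVar 11)) st1 in reg2 gr2 lab2.
pose G i := iter i (guess_step k A) (st.1 6, id).
(* The unread part of the guess never grows, so register 7 stays within the bound. *)
have GM i : (G i).1 <= M.
  elim: i => [|i IH] //=; rewrite /G /= -/(G i); case: (G i) IH => Q f /= QM.
  by apply: leq_trans QM; apply: leq_trans (leq_div _ _) (leq_div _ _).
pose Inv i (st' : state) := [/\ forall j, j < 7 -> st'.1 j = st.1 j, st'.1 7 = (G i).1,
  graph_in A st'.2 & labels_in (G i).2 st'.2].
have r21 : st2.1 1 = k by rewrite reg2 //; case: env1.
have := @for_ind M 10 1 SStep st2 Inv; rewrite r21; case=> [|i st' ik [regs Q' gr' lab']|].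
- split=> // [j j7|]; rewrite reg2 //; last by apply/eqP; lia.
  by rewrite /= updE ifN //; apply/eqP; lia.
- have [|||||| regs3 Q3 gr3 lab3 b3] := @step_correct (set_reg 10 st' i) (G i).2 => //.
  + by apply: env_upd => //; case: er => *; split; rewrite regs.
  + by rewrite /= updE /= regs.
  + by rewrite /= updE /= Q'.
  rewrite -[(set_reg 10 st' i).1 7]/(st'.1 7) Q' -surjective_pairing in Q3 lab3.
  split=> //; split=> // j j7; rewrite regs3 // /= updE ifN ?regs //.
  by apply/eqP; lia.
set st3 := sem (SFor 10 1 SStep) st2 => -[regs3 Q3 gr3 lab3] b3.
have env3 : env n k st3.1 by case: er => *; split; rewrite regs3.
have acc := eval_accept gr3 lab3 env3.
rewrite /SGuess -[sem _ _]/(set_reg 5 st3 (st3.1 5 + eval st3.1 st3.2 EAccept)).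
rewrite acc regs3 //; split; [|by []|exact: gr3|].
- by move=> j j5; rewrite /= updE ifN ?regs3 //; [lia|apply/eqP; lia].
split; first exact: NM.
split; first exact: b2.
split; first exact: b3.
apply: (@bounded_set _ _ _ _ (st3.1 5 + eval st3.1 st3.2 EAccept)) => //.
by rewrite acc regs3 //; apply: leq_trans r5M; rewrite -[X in _ <= X]addn1 leq_add2l leq_b1.
Qed.

Lemma sem_set v e st x : eval st.1 st.2 e = x -> sem (SSet v e) st = set_reg v st x.
Proof. by move=> <-. Qed.

Definition guesses : nat := (base k * base k) ^ k.

Lemma init_correct st : st.1 0 = n -> st.1 1 = k ->
  1 + n * n + 2 * k + base k + base k * base k + guesses <= M ->
  let st' := sem SInit st in
  [/\ env n k st'.1, st'.1 3 = base k, st'.1 4 = guesses, st'.1 5 = st.1 5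
    & st'.2 = st.2 /\ bounded_run M SInit st].
Proof.
move=> r0 r1 leM; rewrite /SInit.
set s6 := SFor 10 1 _.
set e1 := EMul 0 (EVar 0); set e2 := EAdd (EAdd (EVar 1) (EVar 1)) (EConst 1).
set e3 := EMul 13 (EVar 13); set e4 := EMul 3 (EVar 3).
have E1 : eval st.1 st.2 e1 = n * n by rewrite (@eval_mul _ _ _ _ n) ?r0.
pose st1 := set_reg 2 st (n * n).
have E2 : eval st1.1 st1.2 e2 = 2 * k + 1 by rewrite /= !updE /= r1 mul2n addnn.
pose st2 := set_reg 13 st1 (2 * k + 1).
have E3 : eval st2.1 st2.2 e3 = base k.
  by rewrite (@eval_mul _ _ _ _ (2 * k + 1)) // -[st2.1 13]/(2 * k + 1) mulnn.
pose st3 := set_reg 3 st2 (base k).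
have E4 : eval st3.1 st3.2 e4 = base k * base k by rewrite (@eval_mul _ _ _ _ (base k)).
pose st4 := set_reg 13 st3 (base k * base k).
have E5 : eval st4.1 st4.2 (EConst 1) = 1 by [].
pose st5 := set_reg 4 st4 1.
pose Inv i (st' : state) := [/\ forall j, j != 4 -> j != 10 -> st'.1 j = st5.1 j,
  st'.1 4 = (base k * base k) ^ i & st'.2 = st.2].
have := @for_ind M 10 1 (SSet 4 (EMul 4 (EVar 13))) st5 Inv.
have -> : st5.1 1 = k by rewrite -r1.
case=> [//|i st' ik [regs r4 m']|[regs r4 m'] b6].
  have E6 : eval (set_reg 10 st' i).1 (set_reg 10 st' i).2 (EMul 4 (EVar 13))
      = (base k * base k) ^ i.+1.
    rewrite (@eval_mul _ _ _ _ (st'.1 13)) // -[(set_reg _ _ _).1 4]/(st'.1 4).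
    by rewrite r4 regs // mulnC expnS.
  split; last first.
    apply: (bounded_set _ E6); apply: leq_trans leM; apply: leq_trans (leq_addl _ _).
    by apply: leq_pexp2l => //; rewrite muln_gt0 base_gt0.
  rewrite (sem_set _ E6); split; [move=> j j4 j10|by []|exact: m'].
  by rewrite -regs // [LHS]updE ifN // [LHS]updE ifN.
have semE : sem (SSeq (SSet 2 e1) (SSeq (SSet 13 e2) (SSeq (SSet 3 e3) (SSeq (SSet 13 e4)
    (SSeq (SSet 4 (EConst 1)) s6))))) st = sem s6 st5.
  rewrite -[LHS]/(sem s6 (sem (SSet 4 (EConst 1)) (sem (SSet 13 e4) (sem (SSet 3 e3)
    (sem (SSet 13 e2) (sem (SSet 2 e1) st)))))).
  by rewrite (sem_set _ E1) (sem_set _ E2) (sem_set _ E3) (sem_set _ E4).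
rewrite semE; split.
- by split; rewrite regs.
- by rewrite regs.
- exact: r4.
- by rewrite regs.
split; first exact: m'.
split; first by apply: (bounded_set _ E1); lia.
rewrite (sem_set _ E1); split; first by apply: (bounded_set _ E2); lia.
rewrite (sem_set _ E2); split; first by apply: (bounded_set _ E3); lia.
rewrite (sem_set _ E3); split; first by apply: (bounded_set _ E4); lia.
rewrite (sem_set _ E4); split; first by apply: (bounded_set _ E5); lia.
exact: b6.
Qed.

Lemma main_correct st : st.1 0 = n -> st.1 1 = k -> st.1 5 = 0 -> graph_in A st.2 ->
  1 + n + n * n + 2 * k + base k + base k * base k + guesses <= M ->
  (sem SMain st).1 0 =
    \sum_(N < guesses) accepting A (iter k (guess_step k A) (nat_of_ord N, id)).2
  /\ bounded_run M SMain st.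
Proof.
move=> r0 r1 r5 gr leM.
have [|env1 b1 g1 s1 [m1 br1]] := init_correct r0 r1; first lia.
set st1 := sem SInit st in env1 b1 g1 s1 m1.
rewrite r5 in s1.
pose acc N : nat := accepting A (iter k (guess_step k A) (N, id)).2.
pose Inv N (st' : state) := [/\ forall j, j < 5 -> st'.1 j = st1.1 j,
  st'.1 5 = \sum_(0 <= i < N) acc i & graph_in A st'.2].
(* The count is at most the number of guesses tried, which keeps register 5 within the bound. *)
have accN N : \sum_(0 <= i < N) acc i <= N.
  elim: N => [|N IH]; first by rewrite big_geq.
  by rewrite big_nat_recr //= -addn1 leq_add // leq_b1.
have := @for_ind M 6 4 SGuess st1 Inv; rewrite g1.
case=> [|N st' NT [regs r5' gr']|[regs r5' gr'] br2].
- by split; rewrite ?big_geq // m1.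
- have [||||||regs2 r52 gr2 br2] := @guess_correct (set_reg 6 st' N) => //.
  + by case: env1 => *; split; rewrite /= updE /= regs.
  + by rewrite /= updE /= regs.
  + rewrite /= updE /= r5'; have := accN N; lia.
  + rewrite /= updE /=; lia.
  + lia.
  split=> //; split=> //.
    by move=> j j5; rewrite regs2 // /= updE ifN ?regs //; apply/eqP; lia.
  by rewrite r52 big_nat_recr //= !updE /= r5'.
set st2 := sem (SFor 6 4 SGuess) st1 in regs r5' gr'.
split; first by rewrite -[LHS]/(st2.1 5) r5' big_mkord.
split; first exact: br1.
split; first exact: br2.
apply: (@bounded_set _ _ _ _ (st2.1 5)) => //; rewrite r5'.
have := accN guesses; lia.
Qed.

End Statements.

(** * Input encoding and time bound *)

Lemma nth_allpairs (S T U : Type) (F : S -> T -> U) s t x0 y0 z0 i j :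
  i < size s -> j < size t ->
  nth z0 [seq F x y | x <- s, y <- t] (i * size t + j) = F (nth x0 s i) (nth y0 t j).
Proof.
elim: s i => [//|x s IH] [|i] //= is_ jt; rewrite nth_cat size_map.
  by rewrite mul0n add0n jt (nth_map y0).
by rewrite mulSn -addnA ifN ?addKn ?IH // -leqNgt leq_addr.
Qed.

Lemma input_graph (G : sgraph) k : graph_in (@index_adj G) (memory (input G k)).
Proof.
move=> x y; rewrite /= {2}cardE.
rewrite (nth_allpairs _ (enum_val x) (enum_val y)) -?cardE //.
by rewrite /index_adj -!enum_val_nth.
Qed.

Lemma exp_bound k : (2 * k + 1) ^ (4 * k) <= 81 * k ^ (12 * k).
Proof.
(* The factor 81 is [3 ^ 4], the left side at [k = 1]; at 0 both powers are 1, and from 2 on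
   [2 * k + 1 <= k ^ 3]. *)
case: k => [|[|k]] //; set K := k.+2.
apply: leq_trans (_ : K ^ (12 * K) <= _); last by rewrite leq_pmull.
have -> : K ^ (12 * K) = (K ^ 3) ^ (4 * K) by rewrite -expnM mulnA.
rewrite leq_exp2r ?muln_gt0 // /K !expnS expn0; nia.
Qed.

(** The constant 648 is 8 times 81: the left side is at most four copies of [n1 * n1] plus four of
    [(2 * k + 1) ^ (4 * k)]. Using [maxn 1 n] keeps the bound positive for the empty graph. *)
Lemma resource_bound n k :
  (1 + n + n * n + 2 * k + base k + base k * base k + guesses k).+1
    <= 648 * k ^ (12 * k) * maxn 1 n ^ 2.
Proof.
set n1 := maxn 1 n; set E := k ^ (12 * k).
have n1E : n <= n1 * n1 /\ n * n <= n1 * n1 /\ 0 < n1 * n1.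
  rewrite /n1; case: (n) => [|n']; last by rewrite maxnSS max0n; nia.
  by rewrite maxn0.
have E0 : 0 < E by rewrite /E expn_gt0; case: (k) => //; rewrite muln0 orbT.
have := exp_bound k; rewrite -/E; set X := _ ^ (4 * k) => XE.
have gE : guesses k = X by rewrite /guesses /base -expnD -expnM.
rewrite gE -[n1 ^ 2]mulnn.
have kX : 2 * k + base k + base k * base k <= 3 * X.
  rewrite /X /base -expnD; case: (k) => [//|j].
  set Y := 2 * j.+1 + 1.
  have le i : i <= 4 * j.+1 -> Y ^ i <= Y ^ (4 * j.+1).
    by move=> h; apply: leq_pexp2l => //; rewrite /Y addn1.
  have h1 : Y ^ 1 <= Y ^ (4 * j.+1) by apply: le; lia.
  have h2 : Y ^ 2 <= Y ^ (4 * j.+1) by apply: le; lia.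
  have h4 : Y ^ (2 + 2) <= Y ^ (4 * j.+1) by apply: le; lia.
  have : 2 * j.+1 <= Y ^ 1 by rewrite expn1 /Y leq_addr.
  move: (Y ^ 1) (Y ^ 2) (Y ^ (2 + 2)) (Y ^ _) h1 h2 h4 => *; lia.
have [h1 [h2 h3]] := n1E.
have qE : n1 * n1 <= E * (n1 * n1) by rewrite leq_pmull.
have EE : E <= E * (n1 * n1) by rewrite leq_pmulr.
rewrite -mulnA; clear gE E0; clearbody E X n1; lia.
Qed.

Theorem theorem4p4 :
  exists (P : program) (C c d : nat),
    decides_in_time P clique_identification
      (fun n k => C * k ^ (c * k) * maxn 1 n ^ d).
Proof.
have [C [d costE]] := scost_poly SMain.
(* The variables of [SMain] lie below 30, where the scratch registers start. The other witnesses
   come from raising [resource_bound] to the degree [d] of the cost polynomial. *)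
exists (scomp SMain 30 0), (C * 648 ^ d), (12 * d), (2 * d) => G k.
set P := scomp SMain 30 0; set n := #|G|.
pose M := 1 + n + n * n + 2 * k + base k + base k * base k + guesses k.
pose st : state := (reg (input G k), memory (input G k)).
have [ans br] := @main_correct n k M (@index_adj G) st erefl erefl erefl
  (@input_graph G k) (leqnn _).
have bd j : j < 30 -> st.1 j <= M.
  move=> _; case: j => [|[|j]] /=; first by rewrite -/n /M; lia.
    by rewrite /M; lia.
  by rewrite nth_nil.
have [t [rho [run tM ag _ _]]] :=
  @scomp_correct P M 30 SMain 30 0 st.1 st (code_at_self P) erefl (leqnn _)
    (fun _ _ => erefl) bd br.
exists t, (Config (0 + ssize SMain) rho (sem SMain st).2); split.
- apply: star_runs run _.
  (* The program counter stands just past the code, so the machine halts. *)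
  by rewrite /step -[pc _]/(0 + ssize SMain) onth_default // size_scomp.
- apply: leq_trans tM (leq_trans (costE M) _).
  rewrite -!mulnA leq_mul2l; apply/orP; right.
  have -> : 648 ^ d * (k ^ (12 * (d * k)) * maxn 1 n ^ (2 * d))
      = (648 * k ^ (12 * k) * maxn 1 n ^ 2) ^ d.
    have -> : 12 * (d * k) = 12 * k * d by lia.
    by rewrite !expnMn -!expnM -[RHS]mulnA -expnD addnn mul2n.
  by case: (d) => // d'; rewrite leq_exp2r // resource_bound.
rewrite -[reg _ 0]/(rho 0) ag // ans sum_nat_eq0 negb_forall clique_identificationP.
split=> [/existsP[N]|[N NT acc]].
  by rewrite /= eqb0 negbK => acc; exists (N : nat) => //; apply: ltn_ord.
by apply/existsP; exists (Ordinal NT); rewrite /= eqb0 negbK.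
Qed.
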